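(* Let $f,g\in L^2(\mathbb{R}^d)$, and let $a^{(n)},b^{(n)}\in\mathbb{R}^{2d}$ ($n\in\mathbb{N}$) be sequences such that $$|a^{(n)}-b^{(n)}|\to\infty,\qquad c^{(n)}:=\frac{a^{(n)}+b^{(n)}}{2}\to c\in\mathbb{R}^{2d}.$$ Define $$\mathcal{S}_n(z):=W(\pi(a^{(n)})f,\pi(b^{(n)})g)(z)+W(\pi(b^{(n)})g,\pi(a^{(n)})f)(z).$$ Then for every measurable $\Omega\subset\mathbb{R}^{2d}$ with $0<|\Omega|<\infty$ and every $1\le p<\infty$, $$\lim_{n\to\infty}\|\mathcal{S}_n\|_{L^p(\Omega)}=2\,\mathcal{C}_p\,\|W(f,g)\|_{L^p(\Omega-c)}$$ and $$2\,\mathcal{C}_p\,\|W(f,g)\|_{L^p(\Omega-c)}\le L\,\big(\|f\|_{L^2}^2+\|g\|_{L^2}^2\big),$$ where $$L=\sup_{h\in L^2(\mathbb{R}^d)\setminus\{0\}}\frac{\left(\int_{\Omega}|Wh(z)|^p\,dz\right)^{1/p}}{\|h\|_{L^2}^2}$$ and $$\mathcal{C}_p=\left(\frac{1}{2\pi}\int_0^{2\pi}|\cos\theta|^p\,d\theta\right)^{1/p}=\left(\frac{1}{\pi}\,\mathrm{B}\Big(\frac{p+1}{2},\frac12\Big)\right)^{1/p},$$ with $\mathrm{B}$ Euler's beta function.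
   Context: For $f,g\in L^2(\mathbb{R}^d)$ the cross-Wigner distribution is $$W(f,g)(z)=\int_{\mathbb{R}^d} e^{-2\pi i\,\xi\cdot y} f\Big(x+\frac{y}{2}\Big)\overline{g\Big(x-\frac{y}{2}\Big)}\,dy,\qquad z=(x,\xi)\in\mathbb{R}^{2d},$$ and $Wf=W(f,f)$. For $z=(x,\xi)\in\mathbb{R}^{2d}$ the time-frequency shift $\pi(z)$ acts by $\pi(z)f(y)=e^{2\pi i\,\xi\cdot y}f(y-x)$. $|\Omega|$ is Lebesgue measure and $\Omega-c=\{z-c: z\in\Omega\}$. *)

(* Defs.v *)
From HB Require Import structures.
From mathcomp Require Import all_boot all_order all_algebra.
From mathcomp Require Import all_classical all_reals all_analysis.
From mathcomp Require Import measurable_realfun complex.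

Set Implicit Arguments.
Unset Strict Implicit.
Unset Printing Implicit Defensive.

Import Order.TTheory GRing.Theory Num.Theory.
Import numFieldNormedType.Exports.

Local Open Scope classical_set_scope.
Local Open Scope ring_scope.

Definition rV_display : measure_display. Proof. exact: default_measure_display. Qed.

(* The sigma-algebra generated by the coordinates, i.e. the Borel sets of R^n. *)
Section measurable_rV.
Context {R : realType} {n : nat}.

Definition rV_coord (i : 'I_n) (x : 'rV[R]_n) : R := x ord0 i.

HB.instance Definition _ := @isMeasurable.Build rV_display
  'rV[R]_n (g_sigma_preimage rV_coord)
  (@sigma_algebra0 _ setT _) (@sigma_algebraC _ _) (@sigma_algebra_bigcup _ setT _).

Lemma measurable_rV_coord i : measurable_fun [set: 'rV[R]_n] (rV_coord i).
Proof.
move=> _ Y mY; rewrite setTI; apply: sub_sigma_algebra => /=.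
rewrite -bigcup_seq/=; exists i => /=; first by rewrite mem_index_enum.
by exists Y => //; rewrite setTI.
Qed.

Lemma measurable_fun_rVP d (T : measurableType d) (f : T -> 'rV[R]_n) :
  (forall i, measurable_fun setT (rV_coord i \o f)) -> measurable_fun setT f.
Proof.
move=> mf.
suff : g_sigma_preimage (fun i => rV_coord i \o f) `<=` measurable.
  by rewrite g_sigma_preimage_comp => prefS _ A mA; apply: prefS; exists A.
apply: smallest_sub; first exact: sigma_algebra_measurable.
move=> A; rewrite -bigcup_seq => -[i _ [B mB <-]]; exact: mf.
Qed.

End measurable_rV.

(* The canonical sigma-finite structure of a product measure is only found by
   unification when the factors are subprobabilities. *)
Lemma product_sigma_finite d1 d2 (T1 : measurableType d1)
    (T2 : measurableType d2) (R : realType)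
    (m1 : {sigma_finite_measure set T1 -> \bar R})
    (m2 : {sigma_finite_measure set T2 -> \bar R}) :
  sigma_finite setT (m1 \x m2)%E.
Proof.
have /sigma_finiteP[F [TF ndF Foo]] := sigma_finiteT m1.
have /sigma_finiteP[G [TG ndG Goo]] := sigma_finiteT m2.
exists (fun n => F n `*` G n).
  rewrite -setXTT TF TG predeqE => -[x y]; split.
    move=> [/= [n _ Fnx] [k _ Gky]]; exists (maxn n k) => //; split.
    - by move: x Fnx; exact/subsetPset/ndF/leq_maxl.
    - by move: y Gky; exact/subsetPset/ndG/leq_maxr.
  by move=> [n _ []/= ? ?]; split; exists n.
move=> k; have [? ?] := Foo k; have [? ?] := Goo k.
split; first exact: measurableX.
by rewrite product_measure1E// lte_mul_pinfty// ge0_fin_numE.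
Qed.

Section lebesgue_rV.
Context {R : realType}.

Definition rV_cons n (p : R * 'rV[R]_n) : 'rV[R]_n.+1 :=
  \row_(i < n.+1) (if unlift ord0 i is Some j then p.2 ord0 j else p.1).

Lemma measurable_rV_cons n :
  measurable_fun [set: measurableTypeR R * 'rV[R]_n] (@rV_cons n).
Proof.
apply: measurable_fun_rVP => i.
case: (unliftP ord0 i) => [j ->|->].
- rewrite (_ : _ \o _ = rV_coord j \o snd); last first.
    by apply/funext => p; rewrite /rV_coord /= mxE liftK.
  by apply: measurableT_comp => //; exact: measurable_rV_coord.
- rewrite (_ : _ \o _ = fst) //.
  by apply/funext => p; rewrite /rV_coord /= mxE unlift_none.
Qed.

Section step.
Context {n : nat} (m : {sigma_finite_measure set 'rV[R]_n -> \bar R}).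
Local Open Scope ereal_scope.

Definition lebesgue_rV_step : set 'rV[R]_n.+1 -> \bar R :=
  pushforward (@lebesgue_measure R \x m) (@rV_cons n).

Let step0 : lebesgue_rV_step set0 = 0.
Proof. by rewrite /lebesgue_rV_step /pushforward preimage_set0 measure0. Qed.

Let step_ge0 A : 0 <= lebesgue_rV_step A.
Proof. by rewrite /lebesgue_rV_step /pushforward measure_ge0. Qed.

Let step_sigma_additive : semi_sigma_additive lebesgue_rV_step.
Proof.
have mf A : measurable A -> measurable (@rV_cons n @^-1` A).
  by move=> mA; rewrite -[X in measurable X]setTI; exact: measurable_rV_cons.
move=> F mF tF mUF; rewrite /lebesgue_rV_step /pushforward preimage_bigcup.
apply: measure_semi_sigma_additive.
- by move=> n'; exact: mf.
- apply/trivIsetP => /= i j _ _ ij; rewrite -preimage_setI.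
  by move/trivIsetP : tF => /(_ _ _ _ _ ij) ->//; rewrite preimage_set0.
- by rewrite -preimage_bigcup; exact: mf.
Qed.

HB.instance Definition _ := isMeasure.Build _ _ _ lebesgue_rV_step
  step0 step_ge0 step_sigma_additive.

Let rV_cons_inj : injective (@rV_cons n).
Proof.
move=> [x u] [y v] /rowP e; congr pair.
  by have := e ord0; rewrite !mxE unlift_none.
by apply/rowP => j; have := e (lift ord0 j); rewrite !mxE liftK.
Qed.

Let uncons (v : 'rV[R]_n.+1) : measurableTypeR R * 'rV[R]_n :=
  (v ord0 ord0, \row_j v ord0 (lift ord0 j)).

Let unconsK : cancel uncons (@rV_cons n).
Proof.
move=> v; apply/rowP => i; rewrite !mxE.
by case: (unliftP ord0 i) => [j ->|->]; rewrite ?mxE.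
Qed.

Let measurable_uncons : measurable_fun setT uncons.
Proof.
apply: measurable_fun_pair; first exact: (measurable_rV_coord ord0).
apply: measurable_fun_rVP => j.
rewrite (_ : _ \o _ = rV_coord (lift ord0 j)); first exact: measurable_rV_coord.
by apply/funext => v; rewrite /rV_coord /= mxE.
Qed.

Let step_sigma_finite : sigma_finite setT lebesgue_rV_step.
Proof.
have [F UF mF] := product_sigma_finite (@lebesgue_measure R) m.
exists (fun k => uncons @^-1` F k).
  by rewrite -preimage_bigcup -UF preimage_setT.
move=> k; have [mFk Fk] := mF k; split.
  by rewrite -[X in measurable X]setTI; exact: measurable_uncons.
rewrite /lebesgue_rV_step /pushforward -comp_preimage.
rewrite (_ : uncons \o @rV_cons n = id)//.
by apply/funext => p; apply: rV_cons_inj; rewrite /= unconsK.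
Qed.

HB.instance Definition _ := Measure_isSigmaFinite.Build _ _ _ lebesgue_rV_step
  step_sigma_finite.

Lemma lebesgue_rV_step_box (A : 'I_n.+1 -> set R) :
  (forall i, measurable (A i)) ->
  measurable [set v : 'rV[R]_n | forall i, A (lift ord0 i) (v ord0 i)] ->
  lebesgue_rV_step [set v | forall i, A i (v ord0 i)] =
  lebesgue_measure (A ord0) *
  m [set v | forall i, A (lift ord0 i) (v ord0 i)].
Proof.
move=> mA mAl.
rewrite /lebesgue_rV_step /pushforward.
rewrite -(@product_measure1E _ _ (measurableTypeR R) _ _ lebesgue_measure m _ _
  (mA ord0) mAl).
congr (_ _); apply/seteqP; split => [[x v] /= Av|[x v] /= [Ax Av] i].
  split; first by have := Av ord0; rewrite mxE unlift_none.
  by move=> i; have := Av (lift ord0 i); rewrite mxE liftK.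
by rewrite mxE; case: (unliftP ord0 i) => [j ->|->].
Qed.

End step.

(* Lebesgue measure on the Borel sets of R^n; lebesgue_rV_box below gives its
   value on boxes.  Lebesgue measurable sets are the elements of
   completed_algebra_gen (lebesgue_rV n).  On such sets and functions the values
   of lebesgue_rV n, of products of it, and of \int are still the usual ones:
   all of these are monotone, the integral of a nonnegative function being the
   supremum over the Borel simple functions below it. *)
Fixpoint lebesgue_rV n : {sigma_finite_measure set 'rV[R]_n -> \bar R} :=
  match n with
  | 0 => \d_(0 : 'rV[R]_0)
  | k.+1 => lebesgue_rV_step (lebesgue_rV k)
  end.

Lemma measurable_box n (A : 'I_n -> set R) : (forall i, measurable (A i)) ->
  measurable [set v : 'rV[R]_n | forall i, A i (v ord0 i)].
Proof.
move=> mA.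
rewrite (_ : mkset _ = \bigcap_(i in [set: 'I_n]) (rV_coord i @^-1` A i)).
  apply: fin_bigcap_measurable => // i _.
  by rewrite -[X in measurable X]setTI; exact: measurable_rV_coord.
by apply/seteqP; split => v /= Av i => [_|]; exact: Av.
Qed.

Lemma lebesgue_rV_box n (A : 'I_n -> set R) : (forall i, measurable (A i)) ->
  (lebesgue_rV n [set v | forall i, A i (v ord0 i)] =
   \prod_(i < n) lebesgue_measure (A i))%E.
Proof.
elim: n A => [|n IH] A mA /=.
  by rewrite big_ord0 diracE mem_set //= => i; case: i.
rewrite big_ord_recl lebesgue_rV_step_box //; last first.
  by apply: (@measurable_box n (fun i => A (lift ord0 i))) => i; exact: mA.
by congr (_ * _)%E; apply: (IH (fun i => A (lift ord0 i))) => i; exact: mA.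
Qed.

End lebesgue_rV.

(* R^{2d} is represented as the type of pairs z = (x, xi) with z.1 = x and
   z.2 = xi. *)
Section phase_space.
Context {R : realType} {d : nat}.
Local Open Scope ereal_scope.

Definition lebesgue_phase : set ('rV[R]_d * 'rV[R]_d) -> \bar R :=
  lebesgue_rV d \x lebesgue_rV d.

HB.instance Definition _ := Measure.on lebesgue_phase.
HB.instance Definition _ := Measure_isSigmaFinite.Build _ _ _ lebesgue_phase
  (product_sigma_finite (lebesgue_rV d) (lebesgue_rV d)).

End phase_space.
Arguments lebesgue_phase {R} d.

Section wigner.
Context {R : realType} {d : nat}.
Local Open Scope complex_scope.

Definition dotv (u v : 'rV[R]_d) : R := \sum_(i < d) u ord0 i * v ord0 i.

Definition euclidean_norm (z : 'rV[R]_d * 'rV[R]_d) : R :=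
  Num.sqrt (dotv z.1 z.1 + dotv z.2 z.2).

(* e^{it} *)
Definition expi (t : R) : R[i] := cos t +i* sin t.

(* `normc` is the modulus with values in R; the norm of R[i] lives in R[i]. *)
Definition cmod (w : R[i]) : R := ComplexField.Normc.normc w.

Definition cintegral (F : 'rV[R]_d -> R[i]) : R[i] :=
  (\int[lebesgue_rV d]_y complex.Re (F y)) +i*
  (\int[lebesgue_rV d]_y complex.Im (F y)).

Definition L2norm (f : 'rV[R]_d -> R[i]) : \bar R :=
  'N[lebesgue_rV d]_2%:E[EFin \o cmod \o f].

Definition lebesgue_measurable_fun (u : 'rV[R]_d -> R) : Prop :=
  forall B : set R, measurable B ->
  completed_algebra_gen (lebesgue_rV d) (u @^-1` B).

(* Functions, not classes: f represents an element of L^2(R^d; C). *)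
Definition L2 (f : 'rV[R]_d -> R[i]) : Prop :=
  [/\ lebesgue_measurable_fun (fun y => complex.Re (f y)),
      lebesgue_measurable_fun (fun y => complex.Im (f y)) &
      (L2norm f < +oo)%E].

Definition tfshift (z : 'rV[R]_d * 'rV[R]_d) (f : 'rV[R]_d -> R[i])
    (y : 'rV[R]_d) : R[i] :=
  expi (2 * pi * dotv z.2 y) * f (y - z.1).

Definition wigner (f g : 'rV[R]_d -> R[i]) (z : 'rV[R]_d * 'rV[R]_d) : R[i] :=
  cintegral (fun y => expi (- (2 * pi * dotv z.2 y)) *
    f (z.1 + 2^-1 *: y) * (g (z.1 - 2^-1 *: y))^*).

Definition Lpnorm (p : R) (Omega : set ('rV[R]_d * 'rV[R]_d))
    (F : 'rV[R]_d * 'rV[R]_d -> R[i]) : \bar R :=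
  'N[lebesgue_phase d]_p%:E[(EFin \o cmod \o F) \_ Omega].

(* The nonzero elements of L^2 are the classes of functions not vanishing almost
   everywhere. *)
Definition concentration (p : R) (Omega : set ('rV[R]_d * 'rV[R]_d)) : \bar R :=
  ereal_sup [set (Lpnorm p Omega (wigner h h) / L2norm h ^+ 2)%E | h in
    [set h | L2 h /\ ~ (\forall y \ae lebesgue_rV d, h y = 0)]].

End wigner.

Section constants.
Context {R : realType}.

Definition Cp (p : R) : R :=
  ((2 * pi)^-1 * \int[lebesgue_measure]_(t in `[0, 2 * pi]) (`|cos t| `^ p))
    `^ p^-1.

(* The open interval: powR at base 0 with a negative exponent is 0, not +oo. *)
Definition euler_beta (a b : R) : R :=
  \int[lebesgue_measure]_(t in `]0, 1[) (t `^ (a - 1) * (1 - t) `^ (b - 1)).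

End constants.

(* Main.v *)
Require Import Defs.
From mathcomp Require Import finmap.
From mathcomp Require Import all_boot all_order all_algebra.
From mathcomp Require Import all_classical all_reals all_analysis.
From mathcomp Require Import measurable_realfun complex.
From mathcomp Require Import ring lra.
Set Implicit Arguments.
Unset Strict Implicit.
Unset Printing Implicit Defensive.
Import Order.TTheory GRing.Theory Num.Theory.
Import numFieldNormedType.Exports.
Local Open Scope classical_set_scope.
Local Open Scope ring_scope.

(** By Moyal covariance (lemma [wigner_covariance]) the cross term
    W(pi(a)f, pi(b)g)(z) is exp(i theta(z)) W(f,g)(z - (a+b)/2), where theta is an
    affine phase whose gradient has length 2 pi |a - b|, and the other cross term
    is its complex conjugate. Hence |S_n| is 2 |Re(exp(i theta_n) W)| for the fixed
    bounded function W = W(f,g) read around the moving centre c_n, and the phase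
    oscillates faster and faster. On a fixed domain of finite measure
    |cos(theta_n + arg W)|^p is replaced in the limit by its mean over a period,
    which is the p-th power of C_p.

    The averaging ([oscillatory_limit]) rests on translations: a displacement of z
    by t grad(theta_n)/|grad(theta_n)|^2 advances the phase by exactly t, and its
    length tends to 0 uniformly for t in [0, 2 pi]. It preserves Lebesgue measure,
    and since translations are continuous in L^1 ([vanishing_translation_phase])
    and x |-> |x|^p is Lipschitz on bounded sets, replacing W by its translate
    changes the integral by o(1). So the integral with phase theta_n equals the one
    with phase theta_n + t up to o(1), uniformly in t. Averaging over t and
    exchanging the integrals leaves at each point the mean of |Re(exp(it) W)|^p,
    which is C_p^p |W|^p. The moving domain A - c_n is exchanged for A - c by
    continuity of translations once more ([interference_limit]).

    The inequality holds already for each n, before the limit. With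
    u = pi(a)f and v = pi(b)g, polarization gives
    2 (W(u,v) + W(v,u)) = W(u+v) - W(u-v); the L^p norm of each term on the right
    is at most L times the energy of u+v or u-v, and by the parallelogram law
    these energies add up to 2 (|f|^2 + |g|^2) ([interference_le]).

    The functions and the domain are only Lebesgue measurable, while the measures
    are defined on Borel sets. Both are first replaced by Borel representatives,
    which changes nothing outside a null set, hence no integral
    ([eq_integral_off_null], [L2_borel_rep], [completed_Lpnorm]). The formula for
    C_p by the beta function is the substitution t = cos^2 x on a quarter period
    ([Cp_beta]). *)

(** * Integrals and null sets *)

Section null_sets.
Context d (T : measurableType d) (R : realType) (mu : {measure set T -> \bar R}).
Local Open Scope ereal_scope.

Import HBNNSimple.

(** The integral of any nonnegative function is the supremum of the integrals of
    the simple functions below it, hence monotone, measurable or not. *)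
Lemma ge0_le_integral_any (f g : T -> \bar R) :
  (forall x, 0 <= f x) -> (forall x, f x <= g x) ->
  \int[mu]_x f x <= \int[mu]_x g x.
Proof.
move=> f0 fg; have g0 x : 0 <= g x by exact: le_trans (fg x).
rewrite !ge0_integralE// !patch_setT; apply: le_ereal_sup => _ [h /= hf <-].
by exists h => // x; exact: le_trans (fg x).
Qed.

(** A simple function below [f] becomes one below [g], with the same integral,
    once it is set to 0 on [N]. *)
Lemma ge0_le_integral_off_null (N : set T) (f g : T -> \bar R) :
  measurable N -> mu N = 0 -> (forall x, 0 <= f x) -> (forall x, 0 <= g x) ->
  (forall x, ~ N x -> f x = g x) -> \int[mu]_x f x <= \int[mu]_x g x.
Proof.
move=> mN N0 f0 g0 fg.
rewrite (ge0_integralE mu (fun x _ => f0 x)) patch_setT.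
apply: ge_ereal_sup => _ [h /= hf <-].
have mNC := measurableC mN.
pose h' : {nnsfun T >-> R} := proj_nnsfun h mNC.
have -> : sintegral mu h = sintegral mu h'.
  rewrite -!integralT_nnsfun.
  apply: ge0_ae_eq_integral => //.
  - exact/measurable_EFinP.
  - exact/measurable_EFinP.
  - by move=> x _; rewrite lee_fin.
  - by move=> x _; rewrite lee_fin.
  - exists N; split => // x /= /not_implyP[_] hx; apply: contrapT => nNx.
    by apply: hx; rewrite /h' /= mindicE mem_set ?mulr1.
rewrite (ge0_integralE mu (fun x _ => g0 x)) patch_setT.
apply: ereal_sup_ubound; exists h' => //= x.
rewrite /= mindicE; have [xN|xN] := boolP (x \in ~` N).
  by rewrite mulr1 -fg ?hf//; move/set_mem : xN.
by rewrite mulr0.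
Qed.

(** This lets null sets be discarded from integrals of functions that are only
    Lebesgue measurable, although the measure lives on the Borel sets. *)
Lemma eq_integral_off_null (N : set T) (f g : T -> \bar R) :
  measurable N -> mu N = 0 -> (forall x, ~ N x -> f x = g x) ->
  \int[mu]_x f x = \int[mu]_x g x.
Proof.
move=> mN N0 fg; rewrite !(integralE _ _ f, integralE _ _ g).
congr (_ - _); apply/eqP; rewrite eq_le; apply/andP; split;
  apply: (ge0_le_integral_off_null mN N0) => // x Nx;
  by rewrite ?(funeposE, funenegE) fg.
Qed.

(** A measurable representative is obtained by setting [u] to 0 on the null
    set where one of the countably many sets {u > q}, q rational, differs from
    its measurable part. *)
Lemma completed_measurable_rep (u : T -> R) :
  (forall B : set R, measurable B -> completed_algebra_gen mu (u @^-1` B)) ->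
  exists (v : T -> R) (N : set T), [/\ measurable_fun setT v, measurable N,
    mu N = 0 & forall x, ~ N x -> u x = v x].
Proof.
move=> mu_.
have /choice[AN HAN] : forall q : rat, exists AN : set T * set T,
    [/\ measurable AN.1, measurable AN.2, mu AN.2 = 0 &
    forall x, ~ AN.2 x -> (ratr q < u x)%R <-> AN.1 x].
  move=> q; have := mu_ _ (measurable_itv `](ratr q : R), +oo[).
  move=> [A mA [N [M [mM M0 NM]]] AN]; exists (A, M); split => //= x Mx.
  transitivity ((A `|` N) x).
    by rewrite AN/= in_itv/= andbT.
  by split => [[//|/NM]|]; [|left].
have codeQ (q : rat) : exists m, unpickle m = Some q.
  by exists (pickle q); exact: pickleK.
pose N := \bigcup_i (if (unpickle i : option rat) is Some q then (AN q).2 else set0).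
have mN : measurable N.
  by apply: bigcupT_measurable => i; case: unpickle => // q; case: (HAN q).
have N0 : mu N = 0.
  apply: (measure_negligible mN); apply: negligible_bigcup => i.
  case: unpickle => [q|]; last exact: negligible_set0.
  by case: (HAN q) => _ ? ? _; exists (AN q).2; split.
have ANN q : (AN q).2 `<=` N.
  have [m Em] := codeQ q.
  by move=> x qx; exists m => //; rewrite Em.
exists (u \_ (~` N))%R, N; split => //; last first.
  by move=> x Nx; rewrite patchE mem_set.
set v := _ \_ _.
have mv (q : rat) : measurable [set x | (ratr q < v x)%R].
  rewrite (_ : mkset _ = ((AN q).1 `&` ~` N) `|`
      (if (ratr q < 0 :> R)%R then N else set0)).
    have [mA _ _ _] := HAN q.
    apply: measurableU; last by case: ifP.
    by apply: measurableI => //; exact: measurableC.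
  have [_ _ _ H] := HAN q.
  apply/seteqP; split => x /=; rewrite /v patchE.
    have [Nx|] := boolP (x \in ~` N).
      move=> qu; left; split; last exact: (set_mem Nx).
      by apply/(H x) => // /ANN; exact: (set_mem Nx).
    rewrite notin_setE/= => /contrapT Nx q0; right.
    by rewrite q0.
  case=> [[Ax Nx]|].
    by rewrite mem_set//; apply/H => // /ANN.
  case: ifP => // q0 Nx; rewrite memNset//=; exact.
apply: (measurability _ (RGenOInfty.measurableE R)) => //.
move=> _ [_ [r ->] <-]; rewrite setTI.
rewrite (_ : _ @^-1` _ = \bigcup_i (if (unpickle i : option rat) is Some q then
   (if (r < ratr q)%R then [set x | (ratr q < v x)%R] else set0) else set0)).
  by apply: bigcupT_measurable => i; case: unpickle => // q; case: ifP.
apply/seteqP; split => x /=; rewrite in_itv/= andbT.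
  move=> /rat_in_itvoo[q]; rewrite in_itv/= => /andP[rq qx].
  have [m Em] := codeQ q.
  by exists m => //; rewrite Em rq.
move=> [i _]; case: unpickle => // q; case: ifP => //= rq; exact: lt_trans.
Qed.

End null_sets.

(** * Affine changes of variables *)

Section affine_change_of_variables.
Context {R : realType}.
Local Open Scope ereal_scope.
Notation mu := (@lebesgue_measure R).

(** Both sides agree on intervals, which determine Lebesgue measure. *)
Lemma lebesgue_measure_affine_gt0 (r t : R) (A : set R) : (0 < r)%R -> measurable A ->
  mu A = r%:E * mu ((fun x => r * x + t)%R @^-1` A).
Proof.
move=> r0 mA.
pose T := (fun x => r * x + t)%R : measurableTypeR R -> measurableTypeR R.
have mT : measurable_fun setT T.
  by apply: measurable_funD => //; exact: measurable_funM.
pose m : {measure set _ -> \bar R} := mscale (NngNum (ltW r0)) (pushforward mu T).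
rewrite (@lebesgue_measure_unique _ (m mT) _ A)//= => _ [[a b]] /= _ <-.
rewrite /mscale/= /pushforward.
rewrite (_ : _ @^-1` _ = `]((a - t) / r)%R, ((b - t) / r)%R]%classic); last first.
  apply/seteqP; split => x /=; rewrite !in_itv/= /T;
    by rewrite ltr_pdivrMr// ler_pdivlMr// ltrBlDr lerBrDr (mulrC x).
rewrite !lebesgue_measure_itv/= !lte_fin.
rewrite ltr_pM2r ?invr_gt0// ltrBlDr subrK.
case: ifPn => ab; last by rewrite mule0.
rewrite -!EFinD -EFinM; congr EFin; field; exact: lt0r_neq0.
Qed.

Lemma lebesgue_measure_affine (r t : R) (A : set R) : r != 0%R -> measurable A ->
  mu A = `|r|%:E * mu ((fun x => r * x + t)%R @^-1` A).
Proof.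
move=> r0 mA; have [|rlt|/eqP] := ltgtP 0%R r; last by rewrite eq_sym (negbTE r0).
  by move=> rgt; rewrite (lebesgue_measure_affine_gt0 t rgt mA) gtr0_norm.
have Nr : (0 < - r)%R by rewrite oppr_gt0.
rewrite (lebesgue_measure_affine_gt0 t Nr mA) ltr0_norm//; congr (_ * _).
rewrite -lebesgue_measureN.
  by rewrite /pushforward; congr (mu _); apply/seteqP; split => x /=; rewrite mulrNN.
rewrite -[X in measurable X]setTI.
suff : measurable_fun [set: measurableTypeR R] (fun x => - r * x + t)%R by exact.
by apply: measurable_funD => //; exact: measurable_funM.
Qed.

Lemma ge0_integral_affine (r t : R) (h : R -> \bar R) : r != 0%R ->
  measurable_fun [set: measurableTypeR R] h -> (forall x, 0 <= h x) ->
  \int[mu]_x h (r * x + t)%R = `|r|^-1%:E * \int[mu]_x h x.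
Proof.
move=> r0 mh h0.
pose T := (fun x => r * x + t)%R : measurableTypeR R -> measurableTypeR R.
have mT : measurable_fun setT T.
  by apply: measurable_funD => //; exact: measurable_funM.
have nr : (0 <= `|r|)%R by [].
pose m : {measure set _ -> \bar R} := mscale (NngNum nr) (pushforward mu T).
have -> : \int[mu]_x h x =
    \int[m mT]_x h x.
  apply: eq_measure_integral => A mA _.
  exact: (lebesgue_measure_affine t r0 mA).
rewrite ge0_integral_mscale//= muleA -EFinM mulVf ?normr_eq0// mul1e.
by rewrite (ge0_integral_pushforward mT)//= => x _.
Qed.

Lemma ge0_integral_rVS n (h : 'rV[R]_n.+1 -> \bar R) :
  measurable_fun setT h -> (forall x, 0 <= h x) ->
  \int[lebesgue_rV n.+1]_x h x =
  \int[mu]_x \int[lebesgue_rV n]_v h (rV_cons (x, v)).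
Proof.
move=> mh h0.
rewrite (_ : \int[lebesgue_rV n.+1]_x h x =
    \int[pushforward (mu \x lebesgue_rV n) (@rV_cons R n)]_x h x)//.
rewrite (ge0_integral_pushforward (@measurable_rV_cons R n))//= preimage_setT.
apply: (fubini_tonelli1 (m1 := mu) (m2 := lebesgue_rV n) (h \o @rV_cons R n)) => //.
  by apply: measurableT_comp => //; exact: measurable_rV_cons.
by move=> x; exact: h0.
Qed.

Lemma measurable_rV_affine n (r : R) (t : 'rV[R]_n) :
  measurable_fun setT (fun x : 'rV[R]_n => r *: x + t)%R.
Proof.
apply: measurable_fun_rVP => i.
rewrite (_ : _ \o _ = (fun x => r * rV_coord i x + t ord0 i)%R).
  apply: measurable_funD => //; apply: measurable_funM => //.
  exact: measurable_rV_coord.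
by apply/funext => x; rewrite /rV_coord /= !mxE.
Qed.

(** Induction on the dimension: the first coordinate is split off by Tonelli and
    each factor [`|r|^-1] comes from the line. *)
Lemma ge0_integral_rV_affine n (r : R) (t : 'rV[R]_n) (h : 'rV[R]_n -> \bar R) :
  r != 0%R -> measurable_fun setT h -> (forall x, 0 <= h x) ->
  \int[lebesgue_rV n]_x h (r *: x + t)%R =
  (`|r|^-1 ^+ n)%:E * \int[lebesgue_rV n]_x h x.
Proof.
move=> r0; elim: n t h => [|n IH] t h mh h0.
  rewrite expr0 mul1e; congr (integral _ _ _); apply/funext => x.
  by rewrite (thinmx0 (_ + _)%R) (thinmx0 x).
rewrite ge0_integral_rVS//; last first.
  by apply: measurableT_comp => //; exact: measurable_rV_affine.
pose h' x v := h (rV_cons (x, v)).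
have mc : measurable_fun [set: measurableTypeR R * 'rV[R]_n] (h \o @rV_cons R n).
  by apply: measurableT_comp => //; exact: measurable_rV_cons.
have E x v : (r *: rV_cons (x, v) + t)%R =
    rV_cons ((r * x + t ord0 ord0)%R, (r *: v + \row_j t ord0 (lift ord0 j))%R).
  apply/rowP => i; rewrite !mxE; case: (unliftP ord0 i) => [j ->|->] //.
  by rewrite /= !mxE.
have IE x : \int[lebesgue_rV n]_v h (r *: rV_cons (x, v) + t)%R =
    (`|r|^-1 ^+ n)%:E * \int[lebesgue_rV n]_v h' (r * x + t ord0 ord0)%R v.
  under eq_integral do rewrite E.
  apply: (IH _ (h' (r * x + t ord0 ord0)%R)).
  - exact: (measurable_fun_pair2 ((r * x + t ord0 ord0)%R : measurableTypeR R) mc).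
  - by move=> v; exact: h0.
under eq_integral do rewrite IE.
have mF : measurable_fun [set: measurableTypeR R]
    (fun x => \int[lebesgue_rV n]_v h' x v).
  by apply: (measurable_fun_fubini_tonelli_F (h \o @rV_cons R n) mc) => x; exact: h0.
have F0 x : 0 <= \int[lebesgue_rV n]_v h' x v by apply: integral_ge0 => v _; exact: h0.
have mA : measurable_fun [set: measurableTypeR R]
    (fun x => r * x + t ord0 ord0 : measurableTypeR R)%R.
  by apply: measurable_funD => //; exact: measurable_funM.
rewrite (ge0_integralZl mu measurableT (measurableT_comp mF mA) (fun x _ => F0 _)); last first.
  by rewrite lee_fin exprn_ge0// invr_ge0.
rewrite (ge0_integral_affine (t ord0 ord0) r0 mF F0) muleA -EFinM -exprSr.
by rewrite -ge0_integral_rVS.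
Qed.

End affine_change_of_variables.

(** * Continuity of translations in mean *)

Lemma cvge0P (R : realType) (u : (\bar R)^nat) : (forall n, 0 <= u n)%E ->
  u @ \oo --> 0%E <->
  forall e : R, 0 < e -> \forall n \near \oo, (u n <= e%:E)%E.
Proof.
move=> u0; split => [/fine_cvgP[fu /cvgrPdist_le cu] e e0|H].
  near=> n; have fn : u n \is a fin_num by near: n.
  rewrite -(fineK fn) lee_fin.
  have : `|0 - fine (u n)| <= e by near: n; exact: cu.
  by rewrite sub0r normrN ger0_norm// fine_ge0.
have fu : \forall n \near \oo, u n \is a fin_num.
  near=> n; rewrite ge0_fin_numE//.
  apply: (@le_lt_trans _ _ 1%:E); last exact: ltry.
  by near: n; exact: H.
apply/fine_cvgP; split => //; apply/cvgrPdist_le => e e0.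
near=> n; have fn : u n \is a fin_num by near: n.
rewrite sub0r normrN ger0_norm ?fine_ge0// -lee_fin fineK//.
by near: n; exact: H.
Unshelve. all: by end_near. Qed.

Section vanishing_flow.
Context d (T : measurableType d) (R : realType).
Variable mu : {measure set T -> \bar R}.
Local Open Scope ereal_scope.

Definition measure_preserving (tau : T -> T) :=
  measurable_fun setT tau /\
  forall A, measurable A -> mu (tau @^-1` A) = mu A.

Lemma measure_preserving_integral tau (h : T -> \bar R) :
  measure_preserving tau -> measurable_fun setT h -> (forall x, 0 <= h x) ->
  \int[mu]_x h (tau x) = \int[mu]_x h x.
Proof.
move=> [mtau ptau] mh h0.
rewrite -[LHS](ge0_integral_pushforward mtau mu measurableT mh)//.
by apply: eq_measure_integral => A mA _; exact: ptau.
Qed.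

Definition L1_asymp_fixed (tau : nat -> T -> T) (G : T -> R) :=
  \int[mu]_x `|G (tau n x) - G x|%:E @[n --> \oo] --> 0.

(** The maps [tau n] act on L^1 by isometries tending strongly to the identity.
    Small translations are the example in view; the notion is abstract so that
    products and transports of such sequences can be formed. *)
Definition vanishing_flow (tau : nat -> T -> T) :=
  (forall n, measure_preserving (tau n)) /\
  forall G : T -> R, mu.-integrable setT (EFin \o G) -> L1_asymp_fixed tau G.

Variable tau : nat -> T -> T.
Hypothesis ptau : forall n, measure_preserving (tau n).

Let mtau n : measurable_fun setT (tau n). Proof. by case: (ptau n). Qed.

Let mdiff (G : T -> R) n : measurable_fun setT G ->
  measurable_fun setT (fun x => `|G (tau n x) - G x|%:E).
Proof.
move=> mG; apply/measurable_EFinP; apply: measurableT_comp => //.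
by apply: measurable_funB => //; exact: measurableT_comp.
Qed.

Let diff0 (G : T -> R) n : 0 <= \int[mu]_x `|G (tau n x) - G x|%:E.
Proof. by apply: integral_ge0 => x _; rewrite lee_fin. Qed.

Lemma L1_asymp_fixedP G : L1_asymp_fixed tau G <-> forall e : R, (0 < e)%R ->
  \forall n \near \oo, \int[mu]_x `|G (tau n x) - G x|%:E <= e%:E.
Proof. by apply: cvge0P => n; exact: diff0. Qed.

Lemma L1_asymp_fixedD (G H : T -> R) : measurable_fun setT G -> measurable_fun setT H ->
  L1_asymp_fixed tau G -> L1_asymp_fixed tau H -> L1_asymp_fixed tau (G \+ H)%R.
Proof.
move=> mG mH /L1_asymp_fixedP cG /L1_asymp_fixedP cH; apply/L1_asymp_fixedP => e e0.
have e20 : (0 < e / 2)%R by rewrite divr_gt0.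
near=> n.
apply: (@le_trans _ _ (\int[mu]_x (`|G (tau n x) - G x|%:E +
    `|H (tau n x) - H x|%:E))).
  apply: ge0_le_integral => //.
  - by apply: (@mdiff (G \+ H)%R); exact: measurable_funD.
  - by apply: emeasurable_funD; exact: mdiff.
  - by move=> x _; rewrite -EFinD lee_fin/= opprD addrACA; exact: ler_normD.
rewrite ge0_integralD//; [|exact: mdiff|exact: mdiff].
rewrite (splitr e) EFinD leeD//; near: n; [exact: cG|exact: cH].
Unshelve. all: by end_near. Qed.

Lemma L1_asymp_fixedZ (c : R) (G : T -> R) : measurable_fun setT G ->
  L1_asymp_fixed tau G -> L1_asymp_fixed tau (fun x => c * G x)%R.
Proof.
move=> mG cG; rewrite /L1_asymp_fixed.
under eq_fun => n.
  under eq_integral => x _.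
    rewrite -mulrBr normrM EFinM.
  over.
  rewrite ge0_integralZl//; last exact: mdiff.
  over.
rewrite -(mule0 (`|c|%:E)).
exact: cvgeZl.
Qed.

(** Composition with a measure-preserving map is an isometry of L^1, so the
    displacement of [G] is at most that of [H] plus twice the distance from [G] to
    [H]. *)
Lemma L1_asymp_fixed_closed (G : T -> R) : measurable_fun setT G ->
  (forall e : R, (0 < e)%R -> exists H, [/\ measurable_fun setT H,
    L1_asymp_fixed tau H & \int[mu]_x `|G x - H x|%:E <= e%:E]) ->
  L1_asymp_fixed tau G.
Proof.
move=> mG cG; apply/L1_asymp_fixedP => e e0.
have e30 : (0 < e / 3)%R by rewrite divr_gt0.
have [H [mH /L1_asymp_fixedP cH GH]] := cG _ e30.
have mGH : measurable_fun setT (fun x => `|G x - H x|%:E).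
  apply/measurable_EFinP; apply: measurableT_comp => //.
  exact: measurable_funB.
have GH0 x : 0 <= `|G x - H x|%:E by rewrite lee_fin.
near=> n.
apply: (@le_trans _ _ (\int[mu]_x ((`|G (tau n x) - H (tau n x)|%:E +
    `|G x - H x|%:E) + `|H (tau n x) - H x|%:E))).
  apply: ge0_le_integral => //.
  - exact: mdiff.
  - apply: emeasurable_funD; last exact: mdiff.
    by apply: emeasurable_funD => //; exact: (measurableT_comp mGH).
  - move=> x _; rewrite -!EFinD lee_fin/=.
    rewrite (_ : (G (tau n x) - G x) = (G (tau n x) - H (tau n x)) -
      (G x - H x) + (H (tau n x) - H x))%R; last by lra.
    by rewrite (le_trans (ler_normD _ _))// lerD2r; exact: ler_normB.
rewrite ge0_integralD//; last 3 first.
- by move=> x _; rewrite adde_ge0.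
- by apply: emeasurable_funD => //; exact: (measurableT_comp mGH).
- exact: mdiff.
rewrite ge0_integralD//; last exact: (measurableT_comp mGH).
rewrite (measure_preserving_integral (h := fun x => `|G x - H x|%:E) (ptau n))//.
rewrite (_ : e = e / 3 + e / 3 + e / 3)%R; last by lra.
rewrite !EFinD; apply: leeD; first by apply: leeD.
by near: n; exact: cH.
Unshelve. all: by end_near. Qed.

Import HBSimple.

Lemma L1_asymp_fixed_sfun (g : {sfun T >-> R}) :
  (forall A, measurable A -> mu A < +oo -> L1_asymp_fixed tau \1_A) ->
  mu.-integrable setT (EFin \o g) -> L1_asymp_fixed tau g.
Proof.
move=> tau1 ig.
have mg : measurable_fun setT g by apply/measurable_EFinP; case/integrableP : ig.
pose P (G : T -> R) := measurable_fun setT G /\ L1_asymp_fixed tau G.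
suff : P (g : T -> R) by case.
rewrite (_ : (g : T -> R) = (\sum_(r <- fset_set (range g)) fun x =>
  r * \1_(g @^-1` [set r]) x)%R); last first.
  by apply/funext => x; rewrite fct_sumE fimfunE fsbig_finite.
elim/big_ind : _ => [|G H [mG cG] [mH cH]|r _].
  - split; first exact: measurable_cst.
    rewrite /L1_asymp_fixed; under eq_fun do under eq_integral do rewrite subrr normr0.
    by under eq_fun do rewrite integral0; exact: cvg_cst.
  - by split; [exact: measurable_funD|exact: L1_asymp_fixedD].
  set A := _ @^-1` _.
  have mA : measurable A.
    by rewrite -[A]setTI; apply: mg => //; exact: measurable_set1.
  split; first by apply: measurable_funM => //; exact: measurable_indic.
  have [->|r0] := eqVneq r 0%R.
    rewrite /L1_asymp_fixed; under eq_fun do under eq_integral do rewrite !mul0r subrr normr0.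
    by under eq_fun do rewrite integral0; exact: cvg_cst.
  apply: L1_asymp_fixedZ => //; apply: tau1 => //.
  move/integrableP : ig => [_] goo.
  rewrite -(@lte_pmul2l _ `|r|%:E)//; last by rewrite lte_fin normr_gt0.
  rewrite gt0_muley ?lte_fin ?normr_gt0//.
  apply: le_lt_trans goo.
  rewrite -(setIT A) -integral_indic// -ge0_integralZl//; last exact/measurable_EFinP.
  apply: ge0_le_integral => //.
  - by apply: measurable_funeM; exact/measurable_EFinP.
  - by apply: measurableT_comp => //; exact/measurable_EFinP.
  - move=> x _; rewrite -EFinM/= lee_fin indicE.
    have [xA|_] := boolP (x \in A); last by rewrite mulr0.
    by rewrite mulr1 (set_mem xA : g x = r).
Qed.

(** Simple functions are dense in L^1, so indicators suffice. *)
Lemma vanishing_flow_indic :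
  (forall A, measurable A -> mu A < +oo -> L1_asymp_fixed tau \1_A) ->
  vanishing_flow tau.
Proof.
move=> tau1; split => // G iG.
have mG : measurable_fun setT G by apply/measurable_EFinP; case/integrableP : iG.
apply: L1_asymp_fixed_closed => // e e0.
have [g [ig _ gG]] := approximation_sfun_integrable measurableT iG.
have /cvge0P/(_ _ e0) := gG.
have H n : 0 <= \int[mu]_z `|(EFin \o G) z - (g n z)%:E| by exact: integral_ge0.
move=> /(_ H) [n _ /(_ n (leqnn n)) Hn].
by exists (g n); split => //; exact: L1_asymp_fixed_sfun.
Qed.

End vanishing_flow.

Section vanishing_flow_constructions.
Local Open Scope ereal_scope.

(** The image of a product measure is determined by its values on rectangles. *)
Lemma measure_preserving_prod d1 d2 (T1 : measurableType d1) (T2 : measurableType d2)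
    (R : realType) (m1 : {sigma_finite_measure set T1 -> \bar R})
    (m2 : {sigma_finite_measure set T2 -> \bar R}) (t1 : T1 -> T1) (t2 : T2 -> T2) :
  measure_preserving m1 t1 -> measure_preserving m2 t2 ->
  measure_preserving (m1 \x m2) (fun z => (t1 z.1, t2 z.2)).
Proof.
move=> [mt1 pt1] [mt2 pt2].
have mt : measurable_fun setT (fun z : T1 * T2 => (t1 z.1, t2 z.2)).
  by apply: measurable_fun_pair; exact: measurableT_comp.
split => // A mA.
pose m : {measure set (T1 * T2) -> \bar R} :=
  pushforward (m1 \x m2) (fun z : T1 * T2 => (t1 z.1, t2 z.2)).
apply/esym; apply: (product_measure_unique (m' := m mt)) => // B C mB mC.
rewrite /= /pushforward.
rewrite (_ : _ @^-1` _ = (t1 @^-1` B) `*` (t2 @^-1` C))//.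
rewrite product_measure1E ?pt1 ?pt2//.
- by rewrite -[X in measurable X]setTI; exact: mt1.
- by rewrite -[X in measurable X]setTI; exact: mt2.
Qed.

Lemma dominated_cvg0 d (T : measurableType d) (R : realType)
    (mu : {measure set T -> \bar R}) (f : nat -> T -> \bar R) (g : T -> \bar R) :
  (forall n, measurable_fun setT (f n)) ->
  {ae mu, forall x, f n x @[n --> \oo] --> 0} ->
  mu.-integrable setT g -> (forall n x, `|f n x| <= g x) ->
  \int[mu]_x f n x @[n --> \oo] --> 0.
Proof.
move=> mf f0 ig fg.
have [] := @dominated_convergence _ _ _ mu setT measurableT f (cst 0) g mf
  (measurable_cst _) _ ig _.
- by apply: filterS f0 => x + _; exact.
- by apply: aeW => x n _; exact: fg.
- by move=> _ _; rewrite integral0.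
Qed.

(** The coordinates are moved one after the other: almost every section of [G]
    is integrable, its displacement tends to 0, and twice its norm dominates, so
    dominated convergence applies to the other variable. *)
Lemma vanishing_flow_prod d1 d2 (T1 : measurableType d1) (T2 : measurableType d2)
    (R : realType) (m1 : {sigma_finite_measure set T1 -> \bar R})
    (m2 : {sigma_finite_measure set T2 -> \bar R})
    (t1 : nat -> T1 -> T1) (t2 : nat -> T2 -> T2) :
  vanishing_flow m1 t1 -> vanishing_flow m2 t2 ->
  vanishing_flow (m1 \x m2) (fun n z => (t1 n z.1, t2 n z.2)).
Proof.
move=> [pt1 ft1] [pt2 ft2].
have pt n : measure_preserving (m1 \x m2) (fun z => (t1 n z.1, t2 n z.2)).
  exact: measure_preserving_prod.
have mt1 n : measurable_fun setT (t1 n) by case: (pt1 n).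
have mt2 n : measurable_fun setT (t2 n) by case: (pt2 n).
split => // G iG.
have mG : measurable_fun setT G by apply/measurable_EFinP; case/integrableP : iG.
pose H1 n (z : T1 * T2) := `|G (t1 n z.1, z.2) - G z|%:E.
pose H2 n (z : T1 * T2) := `|G (z.1, t2 n z.2) - G z|%:E.
have mH1 n : measurable_fun setT (H1 n).
  apply/measurable_EFinP; apply: measurableT_comp => //.
  apply: measurable_funB => //; apply: (measurableT_comp mG).
  by apply: measurable_fun_pair => //; exact: measurableT_comp.
have mH2 n : measurable_fun setT (H2 n).
  apply/measurable_EFinP; apply: measurableT_comp => //.
  apply: measurable_funB => //; apply: (measurableT_comp mG).
  by apply: measurable_fun_pair => //; exact: measurableT_comp.
have mnG : measurable_fun setT (fun z => `|G z|%:E).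
  by apply/measurable_EFinP; exact: measurableT_comp.
have H10 n z : 0 <= H1 n z by rewrite lee_fin.
have H20 n z : 0 <= H2 n z by rewrite lee_fin.
have c1 : \int[m1 \x m2]_z H1 n z @[n --> \oo] --> 0.
  under eq_fun do rewrite fubini_tonelli2//.
  apply: (dominated_cvg0 (g := fun y => 2%:E * \int[m1]_x `|G (x, y)|%:E)).
  - by move=> n; exact: (measurable_fun_fubini_tonelli_G (H1 n)).
  - have := ae_integrable2 iG; apply: filterS => y iGy.
    exact: (ft1 (fun x => G (x, y))).
  - apply: integrableZl => //; apply/integrableP; split.
      exact: (measurable_fun_fubini_tonelli_G (fun z => `|G z|%:E)).
    under eq_integral do rewrite gee0_abs ?integral_ge0//.
    rewrite -(fubini_tonelli2 (fun z => `|G z|%:E))//.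
    by case/integrableP : iG.
  - move=> n y; rewrite gee0_abs ?integral_ge0//.
    have mGy : measurable_fun setT (fun x => `|G (x, y)|%:E).
      exact: (measurable_fun_pair1 y mnG).
    apply: (@le_trans _ _ (\int[m1]_x (`|G (t1 n x, y)|%:E + `|G (x, y)|%:E))).
      apply: ge0_le_integral => //.
      + exact: (measurable_fun_pair1 y (mH1 n)).
      + by apply: emeasurable_funD => //; exact: (measurableT_comp mGy).
      + by move=> x _; rewrite -EFinD lee_fin; exact: ler_normB.
    rewrite ge0_integralD//; last exact: (measurableT_comp mGy).
    rewrite (measure_preserving_integral (h := fun x => `|G (x, y)|%:E) (pt1 n))//.
    by rewrite (_ : 2%:E = 1%:E + 1%:E)// ge0_muleDl// !mul1e.
have c2 : \int[m1 \x m2]_z H2 n z @[n --> \oo] --> 0.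
  under eq_fun do rewrite fubini_tonelli1//.
  apply: (dominated_cvg0 (g := fun x => 2%:E * \int[m2]_y `|G (x, y)|%:E)).
  - by move=> n; exact: (measurable_fun_fubini_tonelli_F (H2 n)).
  - have := ae_integrable1 iG; apply: filterS => x iGx.
    exact: (ft2 (fun y => G (x, y))).
  - apply: integrableZl => //; apply/integrableP; split.
      exact: (measurable_fun_fubini_tonelli_F (fun z => `|G z|%:E)).
    under eq_integral do rewrite gee0_abs ?integral_ge0//.
    rewrite -(fubini_tonelli1 (fun z => `|G z|%:E))//.
    by case/integrableP : iG.
  - move=> n x; rewrite gee0_abs ?integral_ge0//.
    have mGx : measurable_fun setT (fun y => `|G (x, y)|%:E).
      exact: (measurable_fun_pair2 x mnG).
    apply: (@le_trans _ _ (\int[m2]_y (`|G (x, t2 n y)|%:E + `|G (x, y)|%:E))).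
      apply: ge0_le_integral => //.
      + exact: (measurable_fun_pair2 x (mH2 n)).
      + by apply: emeasurable_funD => //; exact: (measurableT_comp mGx).
      + by move=> y _; rewrite -EFinD lee_fin; exact: ler_normB.
    rewrite ge0_integralD//; last exact: (measurableT_comp mGx).
    rewrite (measure_preserving_integral (h := fun y => `|G (x, y)|%:E) (pt2 n))//.
    by rewrite (_ : 2%:E = 1%:E + 1%:E)// ge0_muleDl// !mul1e.
have {}c1 : forall e : R, (0 < e)%R ->
    \forall n \near \oo, \int[m1 \x m2]_z H1 n z <= e%:E.
  by apply/cvge0P => // n; exact: integral_ge0.
have {}c2 : forall e : R, (0 < e)%R ->
    \forall n \near \oo, \int[m1 \x m2]_z H2 n z <= e%:E.
  by apply/cvge0P => // n; exact: integral_ge0.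
apply/cvge0P => [n|e e0]; first by apply: integral_ge0.
have e20 : (0 < e / 2)%R by rewrite divr_gt0.
near=> n.
apply: (@le_trans _ _ (\int[m1 \x m2]_z (H1 n (z.1, t2 n z.2) + H2 n z))).
  apply: ge0_le_integral => //.
  - apply/measurable_EFinP; apply: measurableT_comp => //.
    by apply: measurable_funB => //; apply: (measurableT_comp mG); case: (pt n).
  - apply: emeasurable_funD => //; apply: (measurableT_comp (mH1 n)).
    by apply: measurable_fun_pair => //; exact: measurableT_comp.
  - by move=> z _; rewrite -EFinD lee_fin; exact: ler_distD.
rewrite ge0_integralD//; last first.
  apply: (measurableT_comp (mH1 n)).
  by apply: measurable_fun_pair => //; exact: measurableT_comp.
rewrite (measure_preserving_integral (h := H1 n) (tau := fun z => (z.1, t2 n z.2)))//; last first.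
  exact: (measure_preserving_prod (t1 := id)).
rewrite (splitr e) EFinD leeD//.
  by near: n; exact: c1.
by near: n; exact: c2.
Unshelve. all: by end_near. Qed.

(** Transport along [phi], which carries [m1] to [m2] and intertwines the flows. *)
Lemma vanishing_flow_conj d1 d2 (T1 : measurableType d1) (T2 : measurableType d2)
    (R : realType) (m1 : {measure set T1 -> \bar R})
    (m2 : {measure set T2 -> \bar R}) (phi : T1 -> T2)
    (t1 : nat -> T1 -> T1) (t2 : nat -> T2 -> T2) :
  measurable_fun setT phi ->
  (forall A, measurable A -> m2 A = m1 (phi @^-1` A)) ->
  (forall n, measurable_fun setT (t2 n)) ->
  (forall n x, t2 n (phi x) = phi (t1 n x)) ->
  vanishing_flow m1 t1 -> vanishing_flow m2 t2.
Proof.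
move=> mphi m2E mt2 t12 [pt1 ft1].
have intE (h : T2 -> \bar R) : measurable_fun setT h -> (forall y, 0 <= h y) ->
    \int[m2]_y h y = \int[m1]_x h (phi x).
  move=> mh h0.
  rewrite -[RHS](ge0_integral_pushforward mphi m1 measurableT mh)//.
  by apply: eq_measure_integral => A mA _; exact: m2E.
split.
  move=> n; split => // A mA.
  rewrite !m2E//; last by rewrite -[X in measurable X]setTI; exact: mt2.
  rewrite -[RHS](pt1 n).2; last by rewrite -[X in measurable X]setTI; exact: mphi.
  by congr (m1 _); apply/seteqP; split => x /=; rewrite t12.
move=> G /integrableP[mG Goo].
have mG' : measurable_fun setT G by exact/measurable_EFinP.
have := ft1 (G \o phi).
rewrite /L1_asymp_fixed.
under [in X in _ -> X]eq_fun => n.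
  rewrite intE//; last first.
    apply/measurable_EFinP; apply: measurableT_comp => //.
    by apply: measurable_funB => //; exact: measurableT_comp.
  under eq_integral do rewrite t12.
  over.
apply; apply/integrableP; split.
  by apply: (measurableT_comp mG).
by move: Goo; rewrite intE//; exact: measurableT_comp.
Qed.

(** Inner and outer regularity squeeze a set A of finite measure between a compact
    and an open set, which a small translation respects; so a small translate of A
    barely leaves A. *)
Lemma vanishing_translation (R : realType) (h : nat -> R) :
  h @ \oo --> 0%R ->
  vanishing_flow (@lebesgue_measure R) (fun n x => (x + h n)%R).
Proof.
move=> h0.
have mp (s : R) : measure_preserving (@lebesgue_measure R) (fun x => (x + s)%R).
  split; first exact: measurable_funD.
  move=> A mA; apply/esym.
  apply: etrans (lebesgue_measure_affine s (oner_neq0 R) mA) _.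
  rewrite normr1 mul1e; congr (lebesgue_measure _).
  by apply/seteqP; split => x /=; rewrite mul1r.
have mpre (A : set R) (s : R) : measurable A ->
    measurable ((fun x => x + s)%R @^-1` A).
  by move=> mA; rewrite -[X in measurable X]setTI; exact: (mp s).1.
(* the part of A outside K and the part of U outside A have measure at most e/2,
   and for small s a point with x + s in K stays in U *)
have small (A : set R) (e : R) : measurable A -> lebesgue_measure A < +oo ->
    (0 < e)%R -> \forall s \near (0%R : R),
    lebesgue_measure (((fun x => x + s)%R @^-1` A) `\` A) <= e%:E.
  move=> mA Aoo e0.
  have e20 : (0 < e / 2)%R by rewrite divr_gt0.
  have [U [oU AU UA]] := lebesgue_regularity_outer mA Aoo e20.
  have [K [cK KA AK]] := lebesgue_regularity_inner mA Aoo e20.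
  have mU : measurable U by exact: open_measurable.
  have mK : measurable K by apply: closed_measurable; exact: compact_closed.
  have : \forall s \near (0%R : R), K `<=` (fun y => U (y - s)%R).
    apply: (iffLR (compact_near_coveringP K) cK R (nbhs (0%R : R))
      (fun s y => U (y - s)%R)) => y Ky.
    have : nbhs (y - 0)%R U by rewrite subr0; apply: open_nbhs_nbhs; split => //; exact/AU/KA.
    have : continuous (fun z : R * R => z.1 - z.2)%R.
      by move=> z; apply: cvgB; [exact: cvg_fst|exact: cvg_snd].
    by move=> /(_ (y, 0%R)) /[apply].
  apply: filterS => s KU.
  have mAK : measurable (A `\` K) by exact: measurableD.
  have mUA : measurable (U `\` A) by exact: measurableD.
  apply: (@le_trans _ _ (lebesgue_measure
    (((fun x => x + s)%R @^-1` (A `\` K)) `|` (U `\` A)))).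
    apply: le_measure.
    - by apply/mem_set; apply: measurableD => //; exact: (mpre A s mA).
    - by apply/mem_set; apply: measurableU => //; exact: (mpre _ s mAK).
    - move=> x [/= Axs nAx]; have [Kxs|nK] := pselect (K (x + s)%R); last by left.
      by right; split => //; have := KU _ Kxs; rewrite addrK.
  apply: le_trans; first exact: (measureU2 lebesgue_measure (mpre _ s mAK) mUA).
  rewrite (splitr e) EFinD; apply: leeD; last exact: ltW.
  apply: le_trans (ltW AK); rewrite le_eqVlt; apply/orP; left; apply/eqP.
  exact: (mp s).2.
apply: vanishing_flow_indic => // A mA Aoo.
apply/cvge0P => [n|e e0]; first by apply: integral_ge0.
have e20 : (0 < e / 2)%R by rewrite divr_gt0.
have Nh0 : (- h n)%R @[n --> \oo] --> (0%R : R).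
  by rewrite -oppr0; exact: cvgN.
have S1 := h0 _ (small A _ mA Aoo e20).
have S2 := Nh0 _ (small A _ mA Aoo e20).
near=> n.
have S1n : lebesgue_measure (((fun x => x + h n)%R @^-1` A) `\` A) <= (e / 2)%:E.
  by near: n; exact: S1.
have S2n : lebesgue_measure (((fun x => x - h n)%R @^-1` A) `\` A) <= (e / 2)%:E.
  by near: n; exact: S2.
(* the symmetric difference of A and its translate; its second half is a
   translate of the set estimated for the shift - h n *)
pose B1 := ((fun x => x + h n)%R @^-1` A) `\` A.
pose B2 := A `\` ((fun x => x + h n)%R @^-1` A).
have mB1 : measurable B1 by apply: measurableD => //; exact: mpre.
have mB2 : measurable B2 by apply: measurableD => //; exact: mpre.
rewrite (_ : \int[_]_x _ = \int[lebesgue_measure]_x ((\1_B1 x)%:E + (\1_B2 x)%:E)); last first.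
  apply: eq_integral => x _; rewrite -EFinD; congr EFin.
  rewrite !indicE /B1 /B2 !in_setD.
  rewrite (_ : (x \in (fun x => x + h n)%R @^-1` A) = (x + h n \in A)%R)//.
  case: (_ \in _); case: (_ \in _);
  by rewrite /= ?(subr0, sub0r, subrr, addr0, add0r, normr0, normr1, normrN1).
rewrite ge0_integralD//; [|exact/measurable_EFinP|exact/measurable_EFinP].
rewrite !integral_indic// !setIT (splitr e) EFinD; apply: leeD; first exact: S1n.
apply: le_trans S2n; rewrite le_eqVlt; apply/orP; left; apply/eqP.
apply: etrans (esym ((mp (- h n)%R).2 _ mB2)) _; congr (lebesgue_measure _).
rewrite /B2 /preimage /setD; apply/funext => x /=.
congr (_ /\ ~ A _); exact: (subrK (h n) (x : R)).
Unshelve. all: by end_near. Qed.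

Lemma vanishing_translation_rV (R : realType) k (h : nat -> 'rV[R]_k) :
  (forall i, h n ord0 i @[n --> \oo] --> 0%R) ->
  vanishing_flow (lebesgue_rV k) (fun n x => (x + h n)%R).
Proof.
elim: k h => [|k IH] h h0.
  have E n (x : 'rV[R]_0) : (x + h n)%R = x.
    by rewrite (thinmx0 (_ + _)%R) (thinmx0 x).
  split => [n|G iG].
    by rewrite (_ : (fun x => _) = id); [split|apply/funext => x; rewrite E].
  rewrite /L1_asymp_fixed; apply: cvg_near_cst; apply: nearW => n.
  rewrite (eq_integral (cst 0)) ?integral0// => x _.
  by rewrite E subrr normr0.
pose t n := (\row_j h n ord0 (lift ord0 j))%R : 'rV[R]_k.
have v1 := vanishing_translation (h0 ord0).
have v2 : vanishing_flow (lebesgue_rV k) (fun n x => (x + t n)%R).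
  apply: IH => i; rewrite (_ : (fun n => _) = (fun n => h n ord0 (lift ord0 i))).
    exact: h0.
  by apply/funext => n; rewrite mxE.
have V := vanishing_flow_prod v1 v2.
refine (@vanishing_flow_conj _ _ _ _ R (lebesgue_measure \x lebesgue_rV k)
  (lebesgue_rV k.+1) (@rV_cons R k) _ _
  (@measurable_rV_cons R k) _ _ _ V).
- by [].
- by move=> n; have := measurable_rV_affine 1 (h n); under eq_fun do rewrite scale1r.
- move=> n [x v]; apply/rowP => i; rewrite !mxE.
  by case: (unliftP ord0 i) => [j ->|->] //=; rewrite !mxE.
Qed.

Lemma vanishing_translation_phase (R : realType) k
    (h : nat -> 'rV[R]_k * 'rV[R]_k) :
  (forall i, (h n).1 ord0 i @[n --> \oo] --> 0%R) ->
  (forall i, (h n).2 ord0 i @[n --> \oo] --> 0%R) ->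
  vanishing_flow (lebesgue_phase k) (fun n z => (z + h n)%R).
Proof.
move=> h1 h2.
exact: (vanishing_flow_prod (vanishing_translation_rV h1) (vanishing_translation_rV h2)).
Qed.

End vanishing_flow_constructions.

(** * Averages of |cos|^p over a period *)

Section real_lemmas.
Context {R : realType}.

(** Young's inequality for [y * x `^ (p - 1)], read as the tangent line
    inequality of the convex function [x `^ p]. *)
Lemma powR_tangent (p x y : R) : 1 <= p -> 0 <= x -> 0 <= y ->
  x `^ p - y `^ p <= p * x `^ (p - 1) * (x - y).
Proof.
move=> p1 x0 y0; have p0 : 0 < p by exact: lt_le_trans p1.
move: p1; rewrite le_eqVlt => /predU1P[<-|p1].
  by rewrite subrr powRr0 !powRr1// !mul1r.
have p10 : 0 < p - 1 by rewrite subr_gt0.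
pose q := p / (p - 1).
have q0 : 0 < q by rewrite divr_gt0.
have pq : p^-1 + q^-1 = 1.
  by rewrite /q invf_div; field; rewrite lt0r_neq0.
have := conjugate_powR y0 (powR_ge0 x (p - 1)) p0 q0 pq.
rewrite -powRrM (_ : (p - 1) * q = p); last first.
  by rewrite /q; field; rewrite lt0r_neq0.
have qE : q^-1 = (p - 1) / p by rewrite /q invf_div.
rewrite qE -(ler_pM2l p0) (_ : p * (_ / p + _) = y `^ p + x `^ p * (p - 1)); last first.
  by field; rewrite lt0r_neq0.
have := mulr_powRB1 x0 p0.
move: (x `^ p) (y `^ p) (x `^ (p - 1)) => X Y Z <-; nra.
Qed.

(** The slope of the tangent at the larger of the two points is bounded by its
    value at [B]. *)
Lemma powR_lipschitz (p B x y : R) : 1 <= p -> 0 <= x <= B -> 0 <= y <= B ->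
  `|x `^ p - y `^ p| <= p * B `^ (p - 1) * `|x - y|.
Proof.
move=> p1.
wlog yx : x y / y <= x.
  move=> H xB yB; have [|/ltW] := leP y x; first by move=> ?; exact: H.
  by move=> ?; rewrite distrC (distrC x); exact: H.
move=> /andP[x0 xB] /andP[y0 yB].
have p0 : 0 <= p by exact: le_trans p1.
rewrite !ger0_norm ?subr_ge0//; last by apply: ge0_ler_powR.
apply: (le_trans (powR_tangent p1 x0 y0)).
apply: ler_wpM2r; first by rewrite subr_ge0.
apply: ler_wpM2l => //; apply: ge0_ler_powR => //.
- by rewrite subr_ge0.
- by rewrite nnegrE (le_trans x0).
Qed.

(** The angle is the arc cosine of u / r, reflected when v < 0. *)
Lemma polar_coordinates (u v : R) : exists2 g, 0 <= g <= 2 * pi &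
  u = Num.sqrt (u ^+ 2 + v ^+ 2) * cos g /\ v = Num.sqrt (u ^+ 2 + v ^+ 2) * sin g.
Proof.
have uv0 : 0 <= u ^+ 2 + v ^+ 2 by rewrite addr_ge0 ?sqr_ge0.
set r := Num.sqrt _.
have r0 : 0 <= r by exact: sqrtr_ge0.
have r2 : r ^+ 2 = u ^+ 2 + v ^+ 2 by rewrite sqr_sqrtr.
have pi0 := pi_ge0 R.
have [r0'|rn0] := eqVneq r 0.
  exists 0; first by rewrite lexx mulr_ge0.
  have : u ^+ 2 + v ^+ 2 == 0 by rewrite -r2 r0' expr0n.
  rewrite paddr_eq0 ?sqr_ge0// !sqrf_eq0 => /andP[/eqP -> /eqP ->].
  by rewrite r0' !mul0r.
have rgt0 : 0 < r by rewrite lt0r rn0.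
have x1 : -1 <= u / r <= 1.
  rewrite -ler_norml -(@ler_pXn2r _ 2)// ?nnegrE// expr1n -normrX ger0_norm ?sqr_ge0//.
  by rewrite expr_div_n r2 ler_pdivrMr -?r2 ?exprn_gt0// mul1r r2 lerDl sqr_ge0.
have cE : cos (acos (u / r)) = u / r by apply: acosK; rewrite in_itv.
have sE : sin (acos (u / r)) = `|v| / r.
  rewrite sin_acos// (_ : 1 - _ = (v / r) ^+ 2).
    by rewrite sqrtr_sqr normrM normfV (ger0_norm r0).
  rewrite !expr_div_n r2; field; rewrite -r2; exact: expf_neq0.
have [v0|v0] := leP 0 v.
  exists (acos (u / r)); first by rewrite acos_ge0//=; have := acos_lepi x1; lra.
  by rewrite cE sE ger0_norm// !mulrA ![r * _]mulrC !mulfK.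
exists (2 * pi - acos (u / r)).
  have := acos_lepi x1; have := acos_ge0 x1; lra.
have -> : 2 * pi - acos (u / r) = - acos (u / r) + pi *+ 2 by rewrite mulr_natl addrC.
rewrite cosD2pi sinD2pi cosN sinN cE sE ltr0_norm//.
by rewrite mulNr opprK !mulrA ![r * _]mulrC !mulfK.
Qed.

Local Notation mu := (@lebesgue_measure R).
Local Open Scope ereal_scope.

Lemma ge0_integral_shift (f : R -> \bar R) (s : R) :
  measurable_fun setT f -> (forall t, 0 <= f t) ->
  \int[mu]_t f (t + s)%R = \int[mu]_t f t.
Proof.
move=> mf f0.
have := ge0_integral_affine s (oner_neq0 R) mf f0.
by under eq_integral do rewrite mul1r; rewrite normr1 invr1 mul1e.
Qed.

Lemma ge0_integral_shift_itv (f : R -> \bar R) (a b s : R) :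
  measurable_fun setT f -> (forall t, 0 <= f t) ->
  \int[mu]_(t in `[a, b[) f (t + s)%R = \int[mu]_(t in `[(a + s)%R, (b + s)%R[) f t.
Proof.
move=> mf f0.
rewrite integral_mkcond [RHS]integral_mkcond.
have mfab : measurable_fun setT (f \_ `[(a + s)%R, (b + s)%R[).
  by apply/(measurable_restrictT f) => //; exact: measurable_funTS.
rewrite -(ge0_integral_shift s mfab); last by move=> t; exact: erestrict_ge0.
apply: eq_integral => t _; rewrite !patchE.
by rewrite !mem_setE !in_itv/= lerD2r ltrD2r.
Qed.

Lemma ge0_integral_itv_split (f : R -> \bar R) (a b c : R) :
  measurable_fun setT f -> (forall t, 0 <= f t) -> (a <= b <= c)%R ->
  \int[mu]_(t in `[a, c[) f t =
  \int[mu]_(t in `[a, b[) f t + \int[mu]_(t in `[b, c[) f t.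
Proof.
move=> mf f0 /andP[ab bc].
rewrite -ge0_integral_setU//=.
- by rewrite -itv_bndbnd_setU.
- exact: measurable_funTS.
- apply/disj_setPS => x/= [] /[!in_itv]/= /andP[_ xb] /andP[bx _].
  by move: (lt_le_trans xb bx); rewrite ltxx.
Qed.

Lemma periodic_integral_shift (f : R -> \bar R) (T s : R) :
  measurable_fun setT f -> (forall t, 0 <= f t) ->
  (forall t, f (t + T)%R = f t) -> (0 <= s <= T)%R ->
  \int[mu]_(t in `[0%R, T]) f (t + s)%R = \int[mu]_(t in `[0%R, T]) f t.
Proof.
move=> mf f0 fT /andP[s0 sT].
have mfs : measurable_fun [set: R] (fun t => f (t + s)%R).
  by apply: measurableT_comp => //; exact: measurable_funD.
rewrite -!integral_itv_bndo_bndc; [|exact: measurable_funTS..].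
rewrite ge0_integral_shift_itv// add0r.
rewrite (ge0_integral_itv_split mf f0 (b := T)) ?sT ?lerDl//.
rewrite (ge0_integral_itv_split mf f0 (a := 0%R) (b := s)) ?s0//.
rewrite addeC; congr (_ + _).
rewrite -[X in `[X, _[](add0r T) (addrC T) -ge0_integral_shift_itv//.
by apply: eq_integral => t _; rewrite fT.
Qed.

Definition cos_moment (p : R) : \bar R :=
  \int[mu]_(t in `[0%R, (2 * pi)%R]) (`|cos t| `^ p)%:E.

Lemma measurable_cosD (s : R) : measurable_fun [set: R] (fun t => cos (t + s)).
Proof.
apply: measurableT_comp; last exact: measurable_funD.
by apply: continuous_measurable_fun; exact: continuous_cos.
Qed.

(** In polar coordinates u cos s - v sin s is r cos (s + g), so its p-th moment
    over a period does not depend on the angles [th] and [g]. *)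
Lemma integral_rotation (p th u v : R) : (0 <= p)%R ->
  \int[mu]_(t in `[0%R, (2 * pi)%R])
    (`|cos (th + t) * u - sin (th + t) * v| `^ p)%:E =
  (Num.sqrt (u ^+ 2 + v ^+ 2) `^ p)%:E * cos_moment p.
Proof.
move=> p0.
pose u' := (cos th * u - sin th * v)%R; pose v' := (sin th * u + cos th * v)%R.
have r_eq : (u' ^+ 2 + v' ^+ 2 = u ^+ 2 + v ^+ 2)%R.
  rewrite -[RHS]mul1r -(cos2Dsin2 th) /u' /v'; ring.
have [g g2 [uE vE]] := polar_coordinates u' v'.
move: uE vE; rewrite r_eq; set r := Num.sqrt _ => uE vE.
have E t : (`|cos (th + t) * u - sin (th + t) * v| `^ p)%:E =
    (r `^ p)%:E * (`|cos (t + g)| `^ p)%:E.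
  rewrite -EFinM -powRM ?sqrtr_ge0//; congr (EFin (powR _ _)).
  rewrite -[X in (_ = X * _)%R](ger0_norm (sqrtr_ge0 _)) -normrM; congr Num.norm.
  rewrite cosD !cosD !sinD mulrBr.
  rewrite (mulrCA r (cos t)) -uE (mulrCA r (sin t)) -vE /u' /v'; ring.
under eq_integral do rewrite E.
have mc (s : R) : measurable_fun [set: R] (fun t => (`|cos (t + s)| `^ p)%:E).
  apply/measurable_EFinP; apply: (measurableT_comp (measurable_powR p)).
  by apply: measurableT_comp => //; exact: measurable_cosD.
have c0 t : 0 <= (`|cos t| `^ p)%:E by rewrite lee_fin powR_ge0.
have mc0 := mc 0%R.
rewrite (ge0_integralZl mu (measurable_itv _) (measurable_funTS (mc g))); last 2 first.
- by move=> t _; exact: c0.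
- by rewrite lee_fin; exact: powR_ge0.
congr (_ * _); rewrite /cos_moment.
apply: (@periodic_integral_shift (fun t => (`|cos t| `^ p)%:E)); last exact: g2.
- by move: mc0; under eq_fun do rewrite addr0.
- exact: c0.
- by move=> t; rewrite mulr_natl cosD2pi.
Qed.

Lemma measurable_cos_powR (p : R) :
  measurable_fun [set: R] (fun t => (`|cos t| `^ p)%:E).
Proof.
apply/measurable_EFinP; apply: (measurableT_comp (measurable_powR p)).
apply: measurableT_comp => //.
by apply: continuous_measurable_fun; exact: continuous_cos.
Qed.

Lemma cos_moment_ge0 (p : R) : 0 <= cos_moment p.
Proof. by apply: integral_ge0 => t _; rewrite lee_fin powR_ge0. Qed.

Lemma integral_two_pi (x : \bar R) :
  \int[mu]_(t in `[0%R, (2 * pi)%R]) (cst x t) = x * (2 * pi)%:E.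
Proof.
have pi0 : (0 < 2 * pi :> R)%R by rewrite mulr_gt0// pi_gt0.
by rewrite integral_cst//= lebesgue_measure_itv/= lte_fin pi0 oppr0 adde0.
Qed.

Lemma period_integral_ge (f : R -> \bar R) (x e : \bar R) :
  measurable_fun setT f -> (forall t, 0 <= f t) -> 0 <= x -> 0 <= e ->
  (forall t, (0 <= t <= 2 * pi)%R -> x <= f t + e) ->
  x * (2 * pi)%:E <= \int[mu]_(t in `[0%R, (2 * pi)%R]) f t + e * (2 * pi)%:E.
Proof.
move=> mf f0 x0 e0 xf.
have mfS := measurable_funTS mf : measurable_fun `[0%R, (2 * pi)%R] f.
rewrite -!integral_two_pi -ge0_integralD//.
by apply: ge0_le_integral => //; exact: emeasurable_funD.
Qed.

Lemma period_integral_le (f : R -> \bar R) (x e : \bar R) :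
  measurable_fun setT f -> (forall t, 0 <= f t) -> 0 <= x -> 0 <= e ->
  (forall t, (0 <= t <= 2 * pi)%R -> f t <= x + e) ->
  \int[mu]_(t in `[0%R, (2 * pi)%R]) f t <= x * (2 * pi)%:E + e * (2 * pi)%:E.
Proof.
move=> mf f0 x0 e0 xf.
have mfS := measurable_funTS mf : measurable_fun `[0%R, (2 * pi)%R] f.
rewrite -!integral_two_pi -ge0_integralD//.
apply: ge0_le_integral => //; first exact: emeasurable_funD.
all: by move=> t; rewrite /= in_itv; exact: xf.
Qed.

Lemma cos_moment_fin_num (p : R) : (0 <= p)%R -> cos_moment p \is a fin_num.
Proof.
move=> p0; rewrite ge0_fin_numE ?cos_moment_ge0//.
apply: (@le_lt_trans _ _ (1 * (2 * pi)%:E)); last by rewrite mul1e ltry.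
rewrite -integral_two_pi; apply: ge0_le_integral => //.
- by apply: measurable_funTS; exact: measurable_cos_powR.
- move=> t _; rewrite lee_fin (_ : 1 = 1 `^ p)%R; last by rewrite powR1.
  by apply: ge0_ler_powR => //; rewrite ?nnegrE// cos_max.
Qed.

(** Uniformity in [t] follows from sequences by choosing, for each [n], a [t]
    that violates the bound whenever there is one; this avoids suprema over [t]. *)
Lemma uniform_of_sequences (S : set R) (E : nat -> R -> \bar R) : S !=set0 ->
  (forall n t, 0 <= E n t) ->
  (forall t_ : nat -> R, (forall n, S (t_ n)) -> E n (t_ n) @[n --> \oo] --> 0) ->
  forall e : R, (0 < e)%R -> \forall n \near \oo, forall t, S t -> E n t <= e%:E.
Proof.
move=> [s0 Ss0] E0 cE e e0.
have /choice[t_ Ht] n : exists t, S t /\ (E n t <= e%:E -> forall t, S t -> E n t <= e%:E).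
  have [[t [St Et]]|nE] := pselect (exists t, S t /\ ~ (E n t <= e%:E)).
    by exists t.
  exists s0; split => // _ t St; apply: contrapT => Et; apply: nE.
  by exists t.
have /cvge0P -/(_ (fun n => E0 n _) e e0) := cE t_ (fun n => (Ht n).1).
by apply: filterS => n; exact: (Ht n).2.
Qed.

End real_lemmas.

(** * Averaging a fast phase *)

Lemma le_integral_perturbation d (T : measurableType d) (R : realType)
    (mu : {measure set T -> \bar R}) (F G D : T -> \bar R) (C : R) :
  measurable_fun setT F -> measurable_fun setT G -> measurable_fun setT D ->
  (forall z, 0 <= F z)%E -> (forall z, 0 <= G z)%E -> (forall z, 0 <= D z)%E ->
  0 <= C -> (forall z, F z <= G z + C%:E * D z)%E ->
  (\int[mu]_z F z <= \int[mu]_z G z + C%:E * \int[mu]_z D z)%E.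
Proof.
move=> mF mG mD F0 G0 D0 C0 FGD.
rewrite -ge0_integralZl//.
have mCD : measurable_fun setT (fun z => C%:E * D z)%E by exact: measurable_funeM.
have CD0 z : (0 <= C%:E * D z)%E by exact: mule_ge0.
rewrite -ge0_integralD//; apply: ge0_le_integral => //.
exact: emeasurable_funD.
Qed.

Section oscillation.
Context d (T : measurableType d) (R : realType).
Variable mu : {sigma_finite_measure set T -> \bar R}.
Variables (u v : T -> R) (M : R) (p : R).
Hypothesis p1 : 1 <= p.
Hypothesis iu : mu.-integrable setT (EFin \o u).
Hypothesis iv : mu.-integrable setT (EFin \o v).
Hypothesis uM : forall z, `|u z| <= M.
Hypothesis vM : forall z, `|v z| <= M.
Local Open Scope ereal_scope.

Let mu_ : measurable_fun setT u.
Proof. by apply/measurable_EFinP; case/integrableP : iu. Qed.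
Let mv_ : measurable_fun setT v.
Proof. by apply/measurable_EFinP; case/integrableP : iv. Qed.

(* the real part of exp(is) (u + iv) *)
Let rot (s : R) z := (cos s * u z - sin s * v z)%R.
Let Psi (s : R) z := (`|rot s z| `^ p)%:E.

Let Psi0 s z : 0 <= Psi s z. Proof. by rewrite lee_fin powR_ge0. Qed.

Let mPsi d' (T' : measurableType d') (f : T' -> R) (g : T' -> T) :
  measurable_fun setT f -> measurable_fun setT g ->
  measurable_fun setT (fun x => Psi (f x) (g x)).
Proof.
move=> mf mg; apply/measurable_EFinP; apply: (measurableT_comp (measurable_powR p)).
apply: measurableT_comp => //.
have mcos : measurable_fun setT (@cos R).
  by apply: continuous_measurable_fun; exact: continuous_cos.
have msin : measurable_fun setT (@sin R).
  by apply: continuous_measurable_fun; exact: continuous_sin.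
by apply: measurable_funB; apply: measurable_funM; apply: measurableT_comp.
Qed.

Let C := (p * (M + M) `^ (p - 1))%R.

Let C0 : (0 <= C)%R.
Proof. by rewrite mulr_ge0 ?powR_ge0// (le_trans _ p1). Qed.

Let rot_le s z : (`|rot s z| <= M + M)%R.
Proof.
rewrite (le_trans (ler_normB _ _))// lerD// normrM.
  by rewrite (le_trans _ (uM z))// ler_piMl// cos_max.
by rewrite (le_trans _ (vM z))// ler_piMl// sin_max.
Qed.

Let Psi_lip s z w :
  Psi s z <= Psi s w + C%:E * (`|u z - u w|%:E + `|v z - v w|%:E).
Proof.
suff : (`|rot s z| `^ p <= `|rot s w| `^ p + C * (`|u z - u w| + `|v z - v w|))%R.
  by rewrite -lee_fin.
rewrite -lerBlDl.
apply: (le_trans (ler_norm _)).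
apply: (le_trans (powR_lipschitz p1 _ _ (B := (M + M)%R))).
- by rewrite normr_ge0 rot_le.
- by rewrite normr_ge0 rot_le.
rewrite ler_wpM2l//; apply: (le_trans (ler_dist_dist _ _)).
rewrite /rot (_ : _ - _ = cos s * (u z - u w) - sin s * (v z - v w))%R; last by ring.
rewrite (le_trans (ler_normB _ _))// lerD// normrM.
  by rewrite ler_piMl// cos_max.
by rewrite ler_piMl// sin_max.
Qed.

Let J := \int[mu]_z (Num.sqrt (u z ^+ 2 + v z ^+ 2) `^ p)%:E.

Lemma integral_modulus_fin_num : J \is a fin_num.
Proof.
have mJ : measurable_fun setT (fun z => (Num.sqrt (u z ^+ 2 + v z ^+ 2) `^ p)%R).
  apply: (measurableT_comp (measurable_powR p)).
  apply: (measurableT_comp (continuous_measurable_fun (@sqrt_continuous R))).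
  by apply: measurable_funD; exact: measurable_funX.
rewrite ge0_fin_numE; last by apply: integral_ge0 => z _; rewrite lee_fin powR_ge0.
apply: (@le_lt_trans _ _ (\int[mu]_z (((M + M) `^ (p - 1))%:E * (`|u z|%:E + `|v z|%:E)))).
  apply: ge0_le_integral => //.
  - exact/measurable_EFinP.
  - by apply: measurable_funeM; apply: emeasurable_funD;
      apply/measurable_EFinP; exact: measurableT_comp.
  - move=> z _; rewrite -EFinD -EFinM lee_fin.
    have r0 := sqrtr_ge0 (u z ^+ 2 + v z ^+ 2).
    have rle : (Num.sqrt (u z ^+ 2 + v z ^+ 2) <= `|u z| + `|v z|)%R.
      rewrite -[leRHS]ger0_norm ?addr_ge0// -sqrtr_sqr ler_wsqrtr//.
      by rewrite sqrrD !real_normK ?num_real// addrAC lerDl mulrn_wge0 ?mulr_ge0.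
    have rM : (Num.sqrt (u z ^+ 2 + v z ^+ 2) <= M + M)%R.
      by rewrite (le_trans rle)// lerD.
    rewrite -mulr_powRB1 ?(lt_le_trans _ p1)// mulrC ler_pM ?powR_ge0//.
    apply: ge0_ler_powR => //; rewrite ?subr_ge0 ?nnegrE//.
    exact: le_trans rM.
have mUV : measurable_fun setT (fun z => `|u z|%:E + `|v z|%:E).
  by apply: emeasurable_funD; apply/measurable_EFinP; exact: measurableT_comp.
have UV0 z : [set: T] z -> 0 <= `|u z|%:E + `|v z|%:E.
  by move=> _; rewrite -EFinD lee_fin addr_ge0.
rewrite (ge0_integralZl mu measurableT mUV UV0); last by rewrite lee_fin powR_ge0.
rewrite ge0_integralD//; [|by apply/measurable_EFinP; exact: measurableT_comp..].
case/integrableP : iu => _ iuoo; case/integrableP : iv => _ ivoo.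
by rewrite lte_mul_pinfty ?lee_fin ?powR_ge0// lte_add_pinfty.
Qed.

(** Equidistribution of the phase: shifting by [tau n t] advances the phase
    by exactly [t] while moving the amplitude (u, v) negligibly in L^1, uniformly
    for t in a period. So the integral equals, up to o(1), its average over [t],
    and by Tonelli that average is computed at each point by
    [integral_rotation]. *)
Lemma oscillatory_limit (th : nat -> T -> R) (tau : nat -> R -> T -> T) :
  (forall n, measurable_fun setT (th n)) ->
  (\forall n \near \oo, forall t z, th n (tau n t z) = th n z + t)%R ->
  (forall t_ : nat -> R, (forall n, 0 <= t_ n <= 2 * pi)%R ->
     vanishing_flow mu (fun n => tau n (t_ n))) ->
  \int[mu]_z (`|cos (th n z) * u z - sin (th n z) * v z| `^ p)%:E @[n --> \oo]
   --> ((2 * pi)^-1)%:E * (J * cos_moment p).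
Proof.
move=> mth thtau flow.
have pi0 : (0 < 2 * pi :> R)%R by rewrite mulr_gt0// pi_gt0.
pose S := [set t : R | 0 <= t <= 2 * pi]%R.
have S0 : S 0%R by rewrite /S/= lexx ltW.
pose E n t := \int[mu]_z (`|u (tau n t z) - u z|%:E + `|v (tau n t z) - v z|%:E).
have ptau n t : S t -> measure_preserving mu (tau n t).
  by move=> St; have [/(_ n)] := flow (fun=> t) (fun=> St).
have mE (w : T -> R) n t : measurable_fun setT w -> S t ->
    measurable_fun setT (fun z => `|w (tau n t z) - w z|%:E).
  move=> mw /(ptau n)[mt _]; apply/measurable_EFinP; apply: measurableT_comp => //.
  by apply: measurable_funB => //; exact: measurableT_comp.
have E0 n t : 0 <= E n t by apply: integral_ge0 => z _; rewrite -EFinD lee_fin addr_ge0.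
have Ecvg t_ : (forall n, S (t_ n)) -> E n (t_ n) @[n --> \oo] --> 0.
  move=> St; have [_ f1] := flow t_ St.
  rewrite /E; under eq_fun => n.
    rewrite ge0_integralD//; [|exact: mE|exact: mE].
    over.
  rewrite -[0]adde0; apply: cvgeD => //; [exact: (f1 u iu)|exact: (f1 v iv)].
have Eunif := uniform_of_sequences (ex_intro _ _ S0) E0 Ecvg.
pose I n := \int[mu]_z Psi (th n z) z.
pose K n t := \int[mu]_z Psi (th n z + t)%R z.
have mK2 n : measurable_fun setT (fun zt : T * R => Psi (th n zt.1 + zt.2)%R zt.1).
  apply: mPsi => //; apply: measurable_funD => //; exact: measurableT_comp.
have mPn n t : measurable_fun setT (fun z => Psi (th n z + t)%R z).
  by apply: mPsi => //; apply: measurable_funD.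
have mPn0 n : measurable_fun setT (fun z => Psi (th n z)%R z) by exact: mPsi.
have KE n t z : Psi (th n z + t)%R z =
    (`|cos (th n z + t) * u z - sin (th n z + t) * v z| `^ p)%:E by [].
have Kavg n : \int[lebesgue_measure]_(t in `[0%R, (2 * pi)%R]) K n t = J * cos_moment p.
  rewrite integral_mkcond.
  pose F (zt : T * measurableTypeR R) :=
    Psi (th n zt.1 + zt.2)%R zt.1 * (\1_(`[0%R, (2 * pi)%R]) zt.2)%:E.
  have mF : measurable_fun setT F.
    apply: emeasurable_funM; first exact: mK2.
    by apply/measurable_EFinP; apply: measurableT_comp.
  have F0 zt : 0 <= F zt by rewrite mule_ge0// lee_fin.
  transitivity (\int[lebesgue_measure]_t \int[mu]_z F (z, t)).
    apply: eq_integral => t _; rewrite patchE /F/= indicE.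
    case: ifPn => tI; last by rewrite integral0_eq// => z _; rewrite mule0.
    by apply: eq_integral => z _; rewrite mule1.
  rewrite -(fubini_tonelli (m1 := mu) (m2 := lebesgue_measure) F mF F0).
  transitivity (\int[mu]_z ((Num.sqrt (u z ^+ 2 + v z ^+ 2) `^ p)%:E * cos_moment p)).
    apply: eq_integral => z _.
    rewrite -(integral_rotation (th n z) _ _ (le_trans ler01 p1)).
    rewrite [RHS]integral_mkcond; apply: eq_integral => t _.
    rewrite patchE /F/= indicE; case: ifPn => tI; last by rewrite mule0.
    by rewrite mule1.
  rewrite ge0_integralZr//.
  - apply/measurable_EFinP; apply: (measurableT_comp (measurable_powR p)).
    apply: (measurableT_comp (continuous_measurable_fun (@sqrt_continuous R))).
    by apply: measurable_funD; exact: measurable_funX.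
  - exact: cos_moment_ge0.
have J0 : 0 <= J by apply: integral_ge0 => z _; rewrite lee_fin powR_ge0.
have Jfin : J \is a fin_num := integral_modulus_fin_num.
have Wfin : cos_moment p \is a fin_num.
  by apply: cos_moment_fin_num; exact: le_trans p1.
have compare n t : S t -> (forall z, th n (tau n t z) = th n z + t)%R ->
    I n <= K n t + C%:E * E n t /\ K n t <= I n + C%:E * E n t.
  move=> St tht.
  have IE : I n = \int[mu]_z Psi (th n z + t)%R (tau n t z).
    apply: etrans (esym (measure_preserving_integral (ptau n t St) (mPn0 n)
      (fun z => Psi0 (th n z) z))) _.
    by apply: eq_integral => z _; rewrite tht.
  have mD : measurable_fun setT (fun z =>
      `|u (tau n t z) - u z|%:E + `|v (tau n t z) - v z|%:E).
    by apply: emeasurable_funD; exact: mE.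
  have mPt : measurable_fun setT (fun z => Psi (th n z + t)%R (tau n t z)).
    by apply: mPsi; [exact: measurable_funD|case: (ptau n t St)].
  have D0 z : 0 <= `|u (tau n t z) - u z|%:E + `|v (tau n t z) - v z|%:E.
    by rewrite -EFinD lee_fin addr_ge0.
  rewrite IE /K /E; split.
    exact: (le_integral_perturbation mu mPt (mPn n t) mD (fun z => Psi0 _ _)
      (fun z => Psi0 _ _) D0 C0 (fun z => Psi_lip (th n z + t)%R (tau n t z) z)).
  apply: (le_integral_perturbation mu (mPn n t) mPt mD (fun z => Psi0 _ _)
      (fun z => Psi0 _ _) D0 C0) => z.
  rewrite (distrC (u _)) (distrC (v _)); exact: Psi_lip.
have mKn n : measurable_fun [set: R] (K n).
  exact: (measurable_fun_fubini_tonelli_G (m1 := mu)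
    (fun zt : T * measurableTypeR R => Psi (th n zt.1 + zt.2)%R zt.1) (mK2 n)).
have K0 n t : 0 <= K n t by apply: integral_ge0.
have I0 n : 0 <= I n by apply: integral_ge0.
pose l := ((2 * pi)^-1 * fine (J * cos_moment p))%R.
have JWE : J * cos_moment p = ((2 * pi) * l)%:E.
  by rewrite /l mulrA divff ?lt0r_neq0// mul1r fineK// fin_numM.
rewrite JWE -EFinM mulrA mulVf ?lt0r_neq0// mul1r.
have key (e : R) : (0 < e)%R -> \forall n \near \oo, I n <= (l + e)%:E /\ l%:E <= I n + e%:E.
  move=> e0.
  have Cp0 : (0 < C + 1)%R by rewrite ltr_wpDl.
  have e'0 : (0 < e / (C + 1))%R by rewrite divr_gt0.
  near=> n.
  have En : forall t, S t -> E n t <= (e / (C + 1))%:E by near: n; exact: Eunif.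
  have tht : forall t z, th n (tau n t z) = (th n z + t)%R by near: n; exact: thtau.
  have CE t : S t -> C%:E * E n t <= e%:E.
    move=> St; apply: (@le_trans _ _ (C%:E * (e / (C + 1))%:E)).
      by rewrite lee_pmul ?lee_fin// En.
    by rewrite -EFinM lee_fin mulrCA ger_pMr// ler_pdivrMr// mul1r lerDl.
  have e0E : 0 <= e%:E by rewrite lee_fin ltW.
  split.
  - have : I n * (2 * pi)%:E <= J * cos_moment p + e%:E * (2 * pi)%:E.
      rewrite -(Kavg n); apply: (period_integral_ge (mKn n) (K0 n) (I0 n) e0E) => t St.
      have [h _] := compare n t St (tht t).
      by rewrite (le_trans h)// leeD2l// CE.
    have -> : J * cos_moment p + e%:E * (2 * pi)%:E = (l + e)%:E * (2 * pi)%:E.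
      by rewrite JWE -!EFinM -EFinD; congr EFin; ring.
    by rewrite lee_pmul2r// lte_fin.
  - have : J * cos_moment p <= I n * (2 * pi)%:E + e%:E * (2 * pi)%:E.
      rewrite -(Kavg n); apply: (period_integral_le (mKn n) (K0 n) (I0 n) e0E) => t St.
      have [_ h] := compare n t St (tht t).
      by rewrite (le_trans h)// leeD2l// CE.
    have -> : J * cos_moment p = l%:E * (2 * pi)%:E.
      by rewrite JWE -!EFinM; congr EFin; ring.
    by rewrite -(ge0_muleDl _ (I0 n) e0E) lee_pmul2r// lte_fin.
have fI : \forall n \near \oo, I n \is a fin_num.
  have := key 1%R ltr01; apply: filterS => n [In _].
  by rewrite ge0_fin_numE// (le_lt_trans In)// ltry.
apply/fine_cvgP; split; first exact: fI.
apply/cvgrPdist_le => e e0.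
near=> n.
have fn : I n \is a fin_num by near: n.
have [h1 h2] : I n <= (l + e)%:E /\ l%:E <= I n + e%:E by near: n; exact: key.
move: h1 h2; rewrite -(fineK fn) -EFinD !lee_fin => h1 h2.
rewrite ler_norml; apply/andP; split; rewrite /= -/(I n); lra.
Unshelve. all: by end_near. Qed.

End oscillation.

(** * Complex-valued functions *)

Lemma measurable_fun_ext d1 d2 (T1 : measurableType d1) (T2 : measurableType d2)
    (g f : T1 -> T2) :
  (forall x, f x = g x) -> measurable_fun setT g -> measurable_fun setT f.
Proof. by move=> /funext ->. Qed.

Section complex_functions.
Context {R : realType}.
Notation Re := (@complex.Re R).
Notation Im := (@complex.Im R).

Lemma ReM (x y : R[i]) : Re (x * y) = Re x * Re y - Im x * Im y.
Proof. by case: x; case: y. Qed.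
Lemma ImM (x y : R[i]) : Im (x * y) = Re x * Im y + Im x * Re y.
Proof. by case: x; case: y. Qed.
Lemma ReD (x y : R[i]) : Re (x + y) = Re x + Re y.
Proof. by case: x; case: y. Qed.
Lemma ImD (x y : R[i]) : Im (x + y) = Im x + Im y.
Proof. by case: x; case: y. Qed.
Lemma ReN (x : R[i]) : Re (- x) = - Re x. Proof. by case: x. Qed.
Lemma ImN (x : R[i]) : Im (- x) = - Im x. Proof. by case: x. Qed.
Lemma ReJ (x : R[i]) : Re (x^*) = Re x. Proof. by case: x. Qed.
Lemma ImJ (x : R[i]) : Im (x^*) = - Im x. Proof. by case: x. Qed.
Lemma complex_ext (x y : R[i]) : Re x = Re y -> Im x = Im y -> x = y.
Proof. by case: x => a b; case: y => c d /= -> ->. Qed.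

(** The squared modulus, which is polynomial in the real and imaginary parts. *)
Definition nsq (x : R[i]) := Re x ^+ 2 + Im x ^+ 2.

Lemma nsq_ge0 (x : R[i]) : 0 <= nsq x. Proof. by rewrite addr_ge0 ?sqr_ge0. Qed.
Lemma nsqM (x y : R[i]) : nsq (x * y) = nsq x * nsq y.
Proof. rewrite /nsq ReM ImM; ring. Qed.
Lemma nsqJ (x : R[i]) : nsq (x^*) = nsq x.
Proof. by rewrite /nsq ReJ ImJ sqrrN. Qed.
Lemma nsq_expi t : nsq (expi t) = 1.
Proof. exact: cos2Dsin2. Qed.
Lemma cmodE (x : R[i]) : cmod x = Num.sqrt (nsq x). Proof. by case: x. Qed.

Lemma parallelogram_nsq (x y : R[i]) :
  nsq (x + y) + nsq (x - y) = 2 * (nsq x + nsq y).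
Proof. rewrite /nsq !(ReD, ImD, ReN, ImN); ring. Qed.

Lemma expiD s t : expi (s + t) = expi s * expi t :> R[i].
Proof. by apply: complex_ext; rewrite ?ReM ?ImM/= ?cosD ?sinD// addrC. Qed.
Lemma expiJ t : (expi t)^* = expi (- t) :> R[i].
Proof. by apply: complex_ext; rewrite ?ReJ ?ImJ/= ?cosN ?sinN. Qed.

(** |xy| is at most (|x|^2 + |y|^2) / 2. *)
Lemma Re_mul_le (x y : R[i]) : `|Re (x * y)| <= 2^-1 * (nsq x + nsq y) /\
  `|Im (x * y)| <= 2^-1 * (nsq x + nsq y).
Proof.
have x0 := nsq_ge0 x; have y0 := nsq_ge0 y.
have H a : a ^+ 2 <= nsq x * nsq y -> `|a| <= 2^-1 * (nsq x + nsq y).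
  move=> aM; have xy0 : 0 <= 2^-1 * (nsq x + nsq y) by lra.
  rewrite -(@ler_pXn2r _ 2)// ?nnegrE//.
  rewrite real_normK ?num_real// (le_trans aM)//.
  by have := sqr_ge0 (nsq x - nsq y); lra.
by split; apply: H; rewrite -nsqM /nsq ?lerDl ?lerDr sqr_ge0.
Qed.

Definition measurableC d (T : measurableType d) (F : T -> R[i]) :=
  measurable_fun setT (Re \o F) /\ measurable_fun setT (Im \o F).

Section measurableC.
Context d (T : measurableType d).
Implicit Types F G : T -> R[i].

Lemma measurableC_M F G : measurableC F -> measurableC G ->
  measurableC (fun x => F x * G x).
Proof.
move=> [F1 F2] [G1 G2]; split.
  apply: (measurable_fun_ext (g := fun x => Re (F x) * Re (G x) - Im (F x) * Im (G x))).
    by move=> x /=; rewrite ReM.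
  by apply: measurable_funB; exact: measurable_funM.
apply: (measurable_fun_ext (g := fun x => Re (F x) * Im (G x) + Im (F x) * Re (G x))).
  by move=> x /=; rewrite ImM.
by apply: measurable_funD; exact: measurable_funM.
Qed.

Lemma measurableC_D F G : measurableC F -> measurableC G ->
  measurableC (fun x => F x + G x).
Proof.
move=> [F1 F2] [G1 G2]; split.
  apply: (measurable_fun_ext (g := fun x => Re (F x) + Re (G x))).
    by move=> x /=; rewrite ReD.
  exact: measurable_funD.
apply: (measurable_fun_ext (g := fun x => Im (F x) + Im (G x))).
    by move=> x /=; rewrite ImD.
exact: measurable_funD.
Qed.

Lemma measurableC_N F : measurableC F -> measurableC (fun x => - F x).
Proof.
move=> [F1 F2]; split.
  apply: (measurable_fun_ext (g := fun x => - Re (F x))).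
    by move=> x /=; rewrite ReN.
  exact: measurableT_comp.
apply: (measurable_fun_ext (g := fun x => - Im (F x))).
    by move=> x /=; rewrite ImN.
exact: measurableT_comp.
Qed.

Lemma measurableC_J F : measurableC F -> measurableC (fun x => (F x)^*).
Proof.
move=> [F1 F2]; split.
  by apply: measurable_fun_ext F1 => x /=; rewrite ReJ.
apply: (measurable_fun_ext (g := fun x => - Im (F x))).
    by move=> x /=; rewrite ImJ.
exact: measurableT_comp.
Qed.

Lemma measurableC_expi (t : T -> R) : measurable_fun setT t ->
  measurableC (fun x => expi (t x)).
Proof.
move=> mt; split; apply: measurableT_comp mt;
  apply: continuous_measurable_fun;
  [exact: continuous_cos|exact: continuous_sin].
Qed.

Lemma measurable_nsq F : measurableC F -> measurable_fun setT (fun x => nsq (F x)).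
Proof.
by move=> [F1 F2]; apply: measurable_funD; exact: measurable_funX.
Qed.

End measurableC.

Lemma measurableC_comp d1 d2 (T1 : measurableType d1) (T2 : measurableType d2)
    (F : T2 -> R[i]) (g : T1 -> T2) :
  measurableC F -> measurable_fun setT g -> measurableC (fun x => F (g x)).
Proof.
move=> [F1 F2] mg; split; [exact: (measurableT_comp F1 mg)|
  exact: (measurableT_comp F2 mg)].
Qed.

Section measurable_rV.
Context d (T : measurableType d) (n : nat).
Implicit Types F G : T -> 'rV[R]_n.

Lemma measurable_rV_coordT F i : measurable_fun setT F ->
  measurable_fun setT (fun x => F x ord0 i).
Proof. by move=> mF; exact: (measurableT_comp (measurable_rV_coord i) mF). Qed.

Lemma measurable_rVD F G : measurable_fun setT F -> measurable_fun setT G ->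
  measurable_fun setT (fun x => F x + G x).
Proof.
move=> mF mG; apply: measurable_fun_rVP => i.
rewrite (_ : _ \o _ = (fun x => F x ord0 i + G x ord0 i)).
  by apply: measurable_funD; exact: measurable_rV_coordT.
by apply/funext => x; rewrite /rV_coord/= mxE.
Qed.

Lemma measurable_rVZ (r : R) F : measurable_fun setT F ->
  measurable_fun setT (fun x => r *: F x).
Proof.
move=> mF; apply: measurable_fun_rVP => i.
rewrite (_ : _ \o _ = (fun x => r * F x ord0 i)).
  by apply: measurable_funM => //; exact: measurable_rV_coordT.
by apply/funext => x; rewrite /rV_coord/= mxE.
Qed.

Lemma measurable_rVB F G : measurable_fun setT F -> measurable_fun setT G ->
  measurable_fun setT (fun x => F x - G x).
Proof.
move=> mF mG.
apply: (measurable_fun_ext (g := fun x => F x + (-1) *: G x)).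
  by move=> x; rewrite scaleN1r.
by apply: measurable_rVD => //; exact: measurable_rVZ.
Qed.

Lemma measurable_dotv F G : measurable_fun setT F -> measurable_fun setT G ->
  measurable_fun setT (fun x => dotv (F x) (G x)).
Proof.
move=> mF mG; apply: measurable_sum => i.
by apply: measurable_funM; exact: measurable_rV_coordT.
Qed.

End measurable_rV.

Lemma measurable_fun_Rintegral d1 d2 (T1 : measurableType d1) (T2 : measurableType d2)
    (m2 : {sigma_finite_measure set T2 -> \bar R}) (h : T1 * T2 -> R) :
  measurable_fun setT h -> measurable_fun setT (fun x => \int[m2]_y h (x, y)).
Proof.
move=> mh.
suff mI : measurable_fun setT (fun x => \int[m2]_y (h (x, y))%:E)%E.
  by apply: (measurableT_comp _ mI); exact: (fine_measurable measurableT).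
have mE : measurable_fun setT (EFin \o h) by exact/measurable_EFinP.
apply: (measurable_fun_ext (g := fun x => \int[m2]_y (EFin \o h)^\+ (x, y) -
  \int[m2]_y (EFin \o h)^\- (x, y))%E) => [x|].
  by rewrite integralE; congr (_ - _)%E; apply: eq_integral => y _; rewrite !(funeposE, funenegE).
apply: emeasurable_funB.
- by apply: (measurable_fun_fubini_tonelli_F (m2 := m2) (EFin \o h)^\+%E
    (measurable_funepos mE)).
- by apply: (measurable_fun_fubini_tonelli_F (m2 := m2) (EFin \o h)^\-%E
    (measurable_funeneg mE)).
Qed.

End complex_functions.

Section cintegral.
Context {R : realType} {n : nat}.
Notation mu := (@lebesgue_rV R n).
Implicit Types F G : 'rV[R]_n -> R[i].

Definition cintegrable F :=
  mu.-integrable setT (EFin \o ((@complex.Re R) \o F)) /\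
  mu.-integrable setT (EFin \o ((@complex.Im R) \o F)).

Lemma cintegralD F G : cintegrable F -> cintegrable G ->
  cintegral (fun y => F y + G y) = cintegral F + cintegral G.
Proof.
move=> [F1 F2] [G1 G2]; apply: complex_ext => /=.
  by rewrite -RintegralD//; apply: eq_Rintegral => y _; rewrite ReD.
by rewrite -RintegralD//; apply: eq_Rintegral => y _; rewrite ImD.
Qed.

Lemma cintegralN F : cintegrable F ->
  cintegral (fun y => - F y) = - cintegral F.
Proof.
move=> [F1 F2]; apply: complex_ext => /=; rewrite -mulN1r -RintegralZl//;
  by apply: eq_Rintegral => y _; rewrite ?ReN ?ImN mulN1r.
Qed.

Lemma cintegralZ (k : R[i]) F : cintegrable F ->
  cintegral (fun y => k * F y) = k * cintegral F.
Proof.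
move=> [F1 F2].
have iZ (r : R) (h : 'rV[R]_n -> R) : mu.-integrable setT (EFin \o h) ->
    mu.-integrable setT (EFin \o (fun y => r * h y)).
  by move=> ih; exact: (integrableZl measurableT r ih).
apply: complex_ext; rewrite ?ReM ?ImM /=.
  rewrite -!RintegralZl// -RintegralB//; [|exact: iZ..].
  by apply: eq_Rintegral => y _; rewrite ReM.
rewrite -!RintegralZl// -RintegralD//; [|exact: iZ..].
by apply: eq_Rintegral => y _; rewrite ImM.
Qed.

Lemma cintegralJ F : cintegrable F ->
  cintegral (fun y => (F y)^*) = (cintegral F)^*.
Proof.
move=> [F1 F2]; apply: complex_ext => /=.
  by apply: eq_Rintegral => y _; rewrite ReJ.
rewrite -mulN1r -RintegralZl//.
by apply: eq_Rintegral => y _; rewrite ImJ mulN1r.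
Qed.

Lemma integral_rV_isometry (h : 'rV[R]_n -> \bar R) (r : R) (t : 'rV[R]_n) :
  `|r| = 1 -> measurable_fun setT h ->
  (\int[mu]_y h (r *: y + t)%R = \int[mu]_y h y)%E.
Proof.
move=> r1 mh.
have r0 : r != 0 by rewrite -normr_eq0 r1 oner_eq0.
have iso (k : 'rV[R]_n -> \bar R) : measurable_fun setT k -> (forall x, 0 <= k x)%E ->
    (\int[mu]_y k (r *: y + t)%R = \int[mu]_y k y)%E.
  by move=> mk k0; rewrite ge0_integral_rV_affine// r1 invr1 expr1n mul1e.
rewrite [LHS]integralE [RHS]integralE; congr (_ - _)%E.
  rewrite -(iso (h ^\+)%E)//; last exact: measurable_funepos.
  by apply: eq_integral => y _; rewrite !funeposE.
rewrite -(iso (h ^\-)%E)//; last exact: measurable_funeneg.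
by apply: eq_integral => y _; rewrite !funenegE.
Qed.

Lemma cintegral_isometry F (r : R) (t : 'rV[R]_n) : `|r| = 1 -> measurableC F ->
  cintegral (fun y => F (r *: y + t)) = cintegral F.
Proof.
move=> r1 [F1 F2]; apply: complex_ext => /=; congr fine.
  exact: (@integral_rV_isometry (EFin \o ((@complex.Re R) \o F)) r t r1
    (iffRL (measurable_EFinP _ _) F1)).
exact: (@integral_rV_isometry (EFin \o ((@complex.Im R) \o F)) r t r1
    (iffRL (measurable_EFinP _ _) F2)).
Qed.

End cintegral.

(** * Cross-Wigner distributions of Borel functions *)

Section wigner_borel.
Context {R : realType} {d : nat}.
Notation rV := 'rV[R]_d.
Notation mu := (@lebesgue_rV R d).
Implicit Types (f g : rV -> R[i]) (z : rV * rV).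

Definition energy f : \bar R := (\int[mu]_y (nsq (f y))%:E)%E.

(** Borel measurable functions are kept apart from the Lebesgue measurable ones
    because only the former compose well and fall under Tonelli's theorem. *)
Definition borelL2 f := measurableC f /\ (energy f < +oo)%E.

Lemma energy_ge0 f : (0 <= energy f)%E.
Proof. by apply: integral_ge0 => y _; rewrite lee_fin nsq_ge0. Qed.

Lemma borelL2_fin f : borelL2 f -> energy f \is a fin_num.
Proof. by move=> [_ foo]; rewrite ge0_fin_numE// energy_ge0. Qed.

Lemma energy_parallelogram f g : measurableC f -> measurableC g ->
  (energy (fun y => f y + g y)%R + energy (fun y => f y - g y)%R =
   2%:E * (energy f + energy g))%E.
Proof.
move=> mf mg.
have mN (h : rV -> R[i]) : measurableC h -> measurable_fun setT (fun y => (nsq (h y))%:E).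
  by move=> mh; apply/measurable_EFinP; exact: measurable_nsq.
have N0 (h : rV -> R[i]) y : (0 <= (nsq (h y))%:E)%E by rewrite lee_fin nsq_ge0.
have mD := measurableC_D mf mg.
have mB : measurableC (fun y => f y - g y).
  by apply: measurableC_D => //; exact: measurableC_N.
have sum_energy (h k : rV -> R[i]) : measurableC h -> measurableC k ->
    (energy h + energy k = \int[mu]_y ((nsq (h y))%:E + (nsq (k y))%:E))%E.
  move=> mh mk; rewrite /energy.
  by rewrite (ge0_integralD mu measurableT (fun y _ => N0 h y) (mN h mh)
    (fun y _ => N0 k y) (mN k mk)).
rewrite !sum_energy//.
have mS : measurable_fun setT (fun y => (nsq (f y))%:E + (nsq (g y))%:E)%E.
  by apply: emeasurable_funD; [exact: (mN f)|exact: (mN g)].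
have S0 y : setT y -> (0 <= (nsq (f y))%:E + (nsq (g y))%:E)%E by move=> _; exact: adde_ge0.
rewrite -(ge0_integralZl mu measurableT mS S0)//.
apply: eq_integral => y _.
by rewrite -!EFinD -EFinM parallelogram_nsq.
Qed.

Lemma borelL2D f g : borelL2 f -> borelL2 g -> borelL2 (fun y => f y + g y).
Proof.
move=> [mf foo] [mg goo]; split; first exact: measurableC_D.
have : (2%:E * (energy f + energy g) < +oo)%E.
  by rewrite lte_mul_pinfty// lte_add_pinfty.
rewrite -energy_parallelogram//; apply: le_lt_trans.
by rewrite leeDl// energy_ge0.
Qed.

Lemma borelL2N f : borelL2 f -> borelL2 (fun y => - f y).
Proof.
move=> [mf foo]; split; first exact: measurableC_N.
rewrite /energy; under eq_integral do rewrite /nsq ReN ImN !sqrrN.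
exact: foo.
Qed.

Lemma measurableC_tfshift z f : measurableC f -> measurableC (tfshift z f).
Proof.
move=> mf; apply: measurableC_M.
  apply: measurableC_expi; apply: measurable_funM => //.
  exact: (measurable_dotv (F := cst z.2) (G := id)).
exact: (measurableC_comp mf (measurable_rVB (@measurable_id _ _ _) (measurable_cst z.1))).
Qed.

Lemma energy_tfshift z f : measurableC f -> energy (tfshift z f) = energy f.
Proof.
move=> mf; rewrite /energy.
under eq_integral do rewrite /tfshift nsqM nsq_expi mul1r.
have mN : measurable_fun setT (fun y => (nsq (f y))%:E).
  by apply/measurable_EFinP; exact: measurable_nsq.
rewrite -[RHS](integral_rV_isometry (- z.1) (normr1 R) mN).
by apply: eq_integral => y _; rewrite scale1r.
Qed.

Lemma borelL2_tfshift z f : borelL2 f -> borelL2 (tfshift z f).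
Proof.
move=> [mf foo]; split; first exact: measurableC_tfshift.
by rewrite energy_tfshift.
Qed.

Definition wigner_integrand f g z (y : rV) : R[i] :=
  expi (- (2 * pi * dotv z.2 y)) * f (z.1 + 2^-1 *: y) * (g (z.1 - 2^-1 *: y))^*.

Lemma measurableC_wigner_integrand d' (T : measurableType d') f g
    (Z : T -> rV * rV) (Y : T -> rV) :
  measurableC f -> measurableC g -> measurable_fun setT Z -> measurable_fun setT Y ->
  measurableC (fun x => wigner_integrand f g (Z x) (Y x)).
Proof.
move=> mf mg mZ mY.
have mZ1 : measurable_fun setT (fun x => (Z x).1) by exact: measurableT_comp.
have mZ2 : measurable_fun setT (fun x => (Z x).2) by exact: measurableT_comp.
apply: measurableC_M; first apply: measurableC_M.
- apply: measurableC_expi; apply: measurableT_comp => //.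
  by apply: measurable_funM => //; exact: measurable_dotv.
- apply: (measurableC_comp (g := fun x => (Z x).1 + 2^-1 *: Y x) mf).
  by apply: measurable_rVD => //; exact: measurable_rVZ.
- apply: measurableC_J; apply: (measurableC_comp (g := fun x => (Z x).1 - 2^-1 *: Y x) mg).
  by apply: measurable_rVB => //; exact: measurable_rVZ.
Qed.

(** The factor 2 ^+ d is the Jacobian of y |-> x + y/2, and 2^-1 comes from
    bounding a product by half the sum of the squares. *)
Definition wigner_bound f g : R := 2^-1 * 2 ^+ d * (fine (energy f) + fine (energy g)).

Lemma integral_wigner_majorant f g z : borelL2 f -> borelL2 g ->
  (\int[mu]_y (2^-1 * (nsq (f (z.1 + 2^-1 *: y)%R) + nsq (g (z.1 - 2^-1 *: y)%R)))%:E =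
   (wigner_bound f g)%:E)%E.
Proof.
move=> bf bg; have [[mf foo] [mg goo]] := (bf, bg).
have mN (h : rV -> R[i]) : measurableC h -> measurable_fun setT (fun y => (nsq (h y))%:E).
  by move=> mh; apply/measurable_EFinP; exact: measurable_nsq.
have N0 (h : rV -> R[i]) y : (0 <= (nsq (h y))%:E)%E by rewrite lee_fin nsq_ge0.
have scale (h : rV -> R[i]) (r : R) : measurableC h -> `|r| = 2^-1 ->
    (\int[mu]_y (nsq (h (z.1 + r *: y)%R))%:E = (2 ^+ d)%:E * energy h)%E.
  move=> mh r2.
  have r0 : r != 0 by rewrite -normr_eq0 r2 invr_eq0 pnatr_eq0.
  have := @ge0_integral_rV_affine _ _ r z.1 _ r0 (mN _ mh) (N0 h).
  rewrite r2 invrK => <-; apply: eq_integral => y _.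
  by rewrite addrC.
have mcomp (h : rV -> R[i]) (r : R) : measurableC h ->
    measurableC (fun y : rV => h (z.1 + r *: y)).
  move=> mh; apply: (measurableC_comp (g := fun y : rV => z.1 + r *: y) mh).
  by apply: measurable_rVD => //; exact: measurable_rVZ.
have s1 := scale f 2^-1 mf (ger0_norm _).
have s2 := scale g (- 2^-1) mg.
under eq_integral => y _ do rewrite -scaleNr EFinM EFinD.
have mS : measurable_fun setT (fun y : rV => (nsq (f (z.1 + 2^-1 *: y)%R))%:E +
    (nsq (g (z.1 + - 2^-1 *: y)%R))%:E)%E.
  by apply: emeasurable_funD; [exact: (mN _ (mcomp f _ mf))|exact: (mN _ (mcomp g _ mg))].
rewrite (ge0_integralZl mu measurableT mS); last 2 first.
- by move=> y _; exact: adde_ge0.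
- by rewrite lee_fin invr_ge0.
rewrite ge0_integralD//; [|exact: (mN _ (mcomp f _ mf))|exact: (mN _ (mcomp g _ mg))].
rewrite s1 ?s2 ?invr_ge0// ?normrN ?ger0_norm ?invr_ge0//.
rewrite -ge0_muleDr ?energy_ge0// -[energy f]fineK ?borelL2_fin//.
rewrite -[energy g]fineK ?borelL2_fin// -EFinD -!EFinM /wigner_bound.
by rewrite mulrA.
Qed.

Lemma wigner_integrand_dom f g z y :
  `|complex.Re (wigner_integrand f g z y)| <=
    2^-1 * (nsq (f (z.1 + 2^-1 *: y)) + nsq (g (z.1 - 2^-1 *: y))) /\
  `|complex.Im (wigner_integrand f g z y)| <=
    2^-1 * (nsq (f (z.1 + 2^-1 *: y)) + nsq (g (z.1 - 2^-1 *: y))).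
Proof.
rewrite /wigner_integrand.
have := Re_mul_le (expi (- (2 * pi * dotv z.2 y)) * f (z.1 + 2^-1 *: y))
  (g (z.1 - 2^-1 *: y))^*.
by rewrite nsqM nsq_expi mul1r nsqJ.
Qed.

Lemma wigner_integrable f g z : borelL2 f -> borelL2 g ->
  cintegrable (wigner_integrand f g z).
Proof.
move=> bf bg.
have [m1 m2] := measurableC_wigner_integrand (Z := cst z) (Y := id) bf.1 bg.1
  (measurable_cst _) (@measurable_id _ _ _).
have H (h : rV -> R) : measurable_fun setT h ->
    (forall y, `|h y| <= 2^-1 * (nsq (f (z.1 + 2^-1 *: y)) + nsq (g (z.1 - 2^-1 *: y)))) ->
    mu.-integrable setT (EFin \o h).
  move=> mh hle; apply/integrableP; split; first exact/measurable_EFinP.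
  apply: (@le_lt_trans _ _ (wigner_bound f g)%:E); last exact: ltry.
  rewrite -(integral_wigner_majorant z bf bg); apply: ge0_le_integral => //.
  - by apply: measurableT_comp => //; exact/measurable_EFinP.
  - apply/measurable_EFinP; apply: measurable_funM => //; apply: measurable_funD.
      apply: measurable_nsq; apply: (measurableC_comp (g := fun y : rV => z.1 + 2^-1 *: y) bf.1).
      by apply: measurable_rVD => //; exact: measurable_rVZ.
    apply: measurable_nsq; apply: (measurableC_comp (g := fun y : rV => z.1 - 2^-1 *: y) bg.1).
    by apply: measurable_rVB => //; exact: measurable_rVZ.
  - by move=> y _; rewrite lee_fin.
by split; apply: H => // y; have [] := wigner_integrand_dom f g z y.
Qed.

Lemma wigner_le f g z : borelL2 f -> borelL2 g ->
  `|complex.Re (wigner f g z)| <= wigner_bound f g /\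
  `|complex.Im (wigner f g z)| <= wigner_bound f g.
Proof.
move=> bf bg; have [i1 i2] := wigner_integrable z bf bg.
have H (h : rV -> R) : mu.-integrable setT (EFin \o h) ->
    (forall y, `|h y| <= 2^-1 * (nsq (f (z.1 + 2^-1 *: y)) + nsq (g (z.1 - 2^-1 *: y)))) ->
    `|\int[mu]_y h y| <= wigner_bound f g.
  move=> ih hle; rewrite -lee_fin EFin_normr_Rintegral//.
  apply: (le_trans (le_abse_integral mu measurableT (measurable_int mu ih))).
  rewrite -(integral_wigner_majorant z bf bg); apply: ge0_le_integral => //.
  - by apply: measurableT_comp => //; exact: (measurable_int mu ih).
  - apply/measurable_EFinP; apply: measurable_funM => //; apply: measurable_funD.
      apply: measurable_nsq; apply: (measurableC_comp (g := fun y : rV => z.1 + 2^-1 *: y) bf.1).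
      by apply: measurable_rVD => //; exact: measurable_rVZ.
    apply: measurable_nsq; apply: (measurableC_comp (g := fun y : rV => z.1 - 2^-1 *: y) bg.1).
    by apply: measurable_rVB => //; exact: measurable_rVZ.
  - by move=> y _; rewrite lee_fin.
split; apply: H => //.
- by move=> y; have [] := wigner_integrand_dom f g z y.
- by move=> y; have [] := wigner_integrand_dom f g z y.
Qed.

Lemma measurableC_wigner f g : measurableC f -> measurableC g ->
  measurableC (wigner f g).
Proof.
move=> mf mg.
have [m1 m2] := measurableC_wigner_integrand
  (Z := fst : (rV * rV) * rV -> rV * rV) (Y := snd : (rV * rV) * rV -> rV) mf mg
  measurable_fst measurable_snd.
split.
- exact: (measurable_fun_Rintegral mu m1).
- exact: (measurable_fun_Rintegral mu m2).
Qed.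

(** The substitution y |-> -y exchanges the two factors. *)
Lemma wigner_herm f g z : borelL2 f -> borelL2 g ->
  wigner g f z = (wigner f g z)^*.
Proof.
move=> bf bg; rewrite -[RHS]cintegralJ; last exact: wigner_integrable.
have mJ : measurableC (fun y => (wigner_integrand f g z y)^*).
  apply: measurableC_J.
  exact: (measurableC_wigner_integrand (Z := cst z) (Y := id) bf.1 bg.1).
rewrite -[RHS](cintegral_isometry (r := -1) 0 (normrN1 _) mJ).
congr cintegral; apply/funext => y; rewrite /wigner_integrand addr0 scaleN1r.
rewrite !rmorphM/= conjCK expiJ scalerN opprK.
rewrite (_ : dotv z.2 (- y) = - dotv z.2 y); last first.
  by rewrite /dotv -sumrN; apply: eq_bigr => i _; rewrite mxE mulrN.
by rewrite mulrN !opprK -!mulrA; congr (_ * _); rewrite mulrC.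
Qed.

Lemma wignerDl f1 f2 g z : borelL2 f1 -> borelL2 f2 -> borelL2 g ->
  wigner (fun y => f1 y + f2 y) g z = wigner f1 g z + wigner f2 g z.
Proof.
move=> b1 b2 bg.
rewrite -[RHS](cintegralD (wigner_integrable z b1 bg) (wigner_integrable z b2 bg)).
by congr cintegral; apply/funext => y; rewrite /wigner_integrand mulrDr mulrDl.
Qed.

Lemma wignerDr f g1 g2 z : borelL2 f -> borelL2 g1 -> borelL2 g2 ->
  wigner f (fun y => g1 y + g2 y) z = wigner f g1 z + wigner f g2 z.
Proof.
move=> bf b1 b2.
rewrite -[RHS](cintegralD (wigner_integrable z bf b1) (wigner_integrable z bf b2)).
by congr cintegral; apply/funext => y; rewrite /wigner_integrand rmorphD mulrDr.
Qed.

Lemma wignerNl f g z : borelL2 f -> borelL2 g ->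
  wigner (fun y => - f y) g z = - wigner f g z.
Proof.
move=> bf bg; rewrite -[RHS](cintegralN (wigner_integrable z bf bg)).
by congr cintegral; apply/funext => y; rewrite /wigner_integrand mulrN mulNr.
Qed.

Lemma wignerNr f g z : borelL2 f -> borelL2 g ->
  wigner f (fun y => - g y) z = - wigner f g z.
Proof.
move=> bf bg; rewrite -[RHS](cintegralN (wigner_integrable z bf bg)).
by congr cintegral; apply/funext => y; rewrite /wigner_integrand rmorphN mulrN.
Qed.

(** In the difference the two diagonal terms cancel and the cross terms double. *)
Lemma wigner_polarization f g z : borelL2 f -> borelL2 g ->
  wigner (fun y => f y + g y) (fun y => f y + g y) z -
  wigner (fun y => f y - g y) (fun y => f y - g y) z =
  2 * (wigner f g z + wigner g f z).
Proof.
move=> bf bg.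
have bN := borelL2N bg; have bD := borelL2D bf bg; have bB := borelL2D bf bN.
rewrite (wignerDl z bf bg bD) (wignerDl z bf bN bB).
rewrite !(wignerDr z bf bf bg) !(wignerDr z bg bf bg).
rewrite !(wignerDr z bf bf bN) !(wignerDr z bN bf bN).
rewrite !(wignerNl, wignerNr)//; ring.
Qed.

Lemma dotvDl (x y w : rV) : dotv (x + y) w = dotv x w + dotv y w.
Proof. by rewrite /dotv -big_split/=; apply: eq_bigr => i _; rewrite mxE mulrDl. Qed.
Lemma dotvZl (r : R) (x w : rV) : dotv (r *: x) w = r * dotv x w.
Proof. by rewrite /dotv mulr_sumr; apply: eq_bigr => i _; rewrite mxE mulrA. Qed.
Lemma dotvC (x w : rV) : dotv x w = dotv w x.
Proof. by apply: eq_bigr => i _; rewrite mulrC. Qed.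
Lemma dotvNl (x w : rV) : dotv (- x) w = - dotv x w.
Proof. by rewrite -scaleN1r dotvZl mulN1r. Qed.
Lemma dotvDr (w x y : rV) : dotv w (x + y) = dotv w x + dotv w y.
Proof. by rewrite dotvC dotvDl !(dotvC w). Qed.
Lemma dotvZr (r : R) (x w : rV) : dotv w (r *: x) = r * dotv w x.
Proof. by rewrite dotvC dotvZl dotvC. Qed.
Lemma dotvNr (x w : rV) : dotv w (- x) = - dotv w x.
Proof. by rewrite dotvC dotvNl dotvC. Qed.

(** An affine function of [z] whose gradient 2 pi (a.2 - b.2, b.1 - a.1) is as
    long as 2 pi |a - b|: this is the phase that oscillates. *)
Definition wigner_phase (a b : rV * rV) z : R :=
  2 * pi * (dotv (a.2 - b.2) z.1 - dotv (z.2 - 2^-1 *: (a.2 + b.2)) (a.1 - b.1)).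

(** The substitution y |-> y + (a.1 - b.1) recentres both factors at the
    midpoint of [a] and [b] and leaves only characters outside. *)
Lemma wigner_covariance f g (a b : rV * rV) z : borelL2 f -> borelL2 g ->
  wigner (tfshift a f) (tfshift b g) z =
  expi (wigner_phase a b z) * wigner f g (z - 2^-1 *: (a + b)).
Proof.
move=> bf bg; set c := 2^-1 *: (a + b).
rewrite -[RHS]cintegralZ; last exact: wigner_integrable.
have mW : measurableC (wigner_integrand (tfshift a f) (tfshift b g) z).
  apply: (measurableC_wigner_integrand (Z := cst z) (Y := id)) => //.
  - by apply: measurableC_tfshift; case: bf.
  - by apply: measurableC_tfshift; case: bg.
rewrite -[LHS](cintegral_isometry (r := 1) (a.1 - b.1) (normr1 _) mW).
congr cintegral; apply/funext => y; rewrite /wigner_integrand /tfshift scale1r.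
pose s := 2^-1 *: (y + (a.1 - b.1)).
rewrite -/s.
rewrite (_ : z.1 + s - a.1 = (z - c).1 + 2^-1 *: y); last first.
  by apply/rowP => i; rewrite /s /c !mxE; lra.
rewrite [X in g X](_ : _ = (z - c).1 - 2^-1 *: y); last first.
  by apply/rowP => i; rewrite /s /c !mxE; lra.
rewrite rmorphM/= expiJ; set F := f _; set G := (g _)^*.
transitivity ((expi (- (2 * pi * dotv z.2 (y + (a.1 - b.1)))) *
   expi (2 * pi * dotv a.2 (z.1 + s)) * expi (- (2 * pi * dotv b.2 (z.1 - s)))) * (F * G)).
  ring.
rewrite -!expiD [RHS]mulrA [in RHS]mulrA -expiD -[RHS]mulrA; congr (expi _ * _).
rewrite /wigner_phase /s /c /= !(dotvDl, dotvDr, dotvZl, dotvZr, dotvNl, dotvNr); field.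
by [].
Qed.

End wigner_borel.

(** * The constant as a beta integral *)

Section beta_constant.
Context {R : realType}.
Notation mu := (@lebesgue_measure R).

Lemma continuous_powR_gt0 (e x : R) : 0 < x -> {for x, continuous (@powR R ^~ e)}.
Proof.
move=> x0; apply: differentiable_continuous; apply/derivable1_diffP.
by have [] := is_derive1_powR e x0.
Qed.

Let cos2 : R -> R := (@cos R * @cos R).

Let is_derive_cos2 (x : R) : is_derive x 1 cos2 (- (2 * cos x * sin x)).
Proof.
rewrite /cos2; apply: is_derive_eq.
by rewrite /GRing.scale/=; ring.
Qed.

Let derive_cos2 (x : R) : derive1 cos2 x = - (2 * cos x * sin x).
Proof. by rewrite derive1E; have [_ ->] := is_derive_cos2 x. Qed.

Let continuous_cos2' : continuous (derive1 cos2).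
Proof.
have -> : derive1 cos2 = (fun x => - (2 * cos x * sin x)).
  by apply/funext => x; exact: derive_cos2.
move=> x; apply: cvgN; apply: cvgM; last exact: continuous_sin.
by apply: cvgM; [exact: cvg_cst|exact: continuous_cos].
Qed.

Let continuous_cos2 : continuous cos2.
Proof. by move=> x; apply: cvgM; exact: continuous_cos. Qed.

Let G (p t : R) : R := t `^ ((p + 1) / 2 - 1) * (1 - t) `^ (1 / 2 - 1).

Let cos2_decr (x y : R) : 0 <= x -> y <= pi / 2 -> x < y -> cos2 y < cos2 x.
Proof.
move=> x0 y2 xy; rewrite /cos2 /= !mulrfctE.
have pi0 := pi_gt0 R.
have c : cos y < cos x by rewrite ltr_cos// in_itv/=; apply/andP; split; lra.
have cy : 0 <= cos y by apply: cos_ge0_pihalf; apply/andP; split; lra.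
by rewrite ltr_pM.
Qed.

(** The substitution t = cos^2 x, away from the endpoints, where the derivative
    of cos^2 vanishes and the integrand may be singular. *)
Lemma beta_substitution_segment (p a b : R) : 0 < a -> a <= b -> b < pi / 2 ->
  (\int[mu]_(t in `[cos2 b, cos2 a]) (G p t)%:E =
   \int[mu]_(x in `[a, b]) (2 * (cos x `^ p))%:E)%E.
Proof.
move=> a0 ab b2; have pi0 := pi_gt0 R.
rewrite (@integration_by_substitution_decreasing _ cos2 (G p) a b ab).
- apply: eq_integral => x /set_mem; rewrite /= in_itv/= => /andP[ax xb].
  have cx : 0 < cos x by apply: cos_gt0_pihalf; apply/andP; split; lra.
  have sx : 0 < sin x by apply: sin_gt0_pihalf; apply/andP; split; lra.
  congr EFin; transitivity (G p (cos x * cos x) * (2 * cos x * sin x)).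
    by rewrite -[2 * _ * _]opprK -derive_cos2.
  rewrite /G.
  have -> : 1 - cos x * cos x = sin x `^ 2 by rewrite powR_mulrn ?ltW// sin2cos2.
  have -> : cos x * cos x = cos x `^ 2 by rewrite powR_mulrn ?ltW.
  rewrite -!powRrM (_ : 2 * (1 / 2 - 1) = -1); last by lra.
  rewrite (_ : 2 * ((p + 1) / 2 - 1) = p - 1); last by lra.
  rewrite powR_inv1 ?ltW// (_ : cos x `^ p = cos x `^ (p - 1) * cos x).
    by field; exact: lt0r_neq0.
  by rewrite -[X in _ * X]powRr1 ?ltW// -powRD ?subrK// lt0r_neq0 ?implybT.
- move=> x y; rewrite !in_itv/= => /andP[ax xb] /andP[ay yb] xy.
  by apply: cos2_decr => //; lra.
- by move=> x _; exact: continuous_cos2'.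
- apply/cvg_ex; exists (derive1 cos2 a); apply: cvg_at_right_filter; exact: continuous_cos2'.
- apply/cvg_ex; exists (derive1 cos2 b); apply: cvg_at_left_filter; exact: continuous_cos2'.
- split.
  + by move=> x _; have [] := is_derive_cos2 x.
  + by apply: cvg_at_right_filter; exact: continuous_cos2.
  + by apply: cvg_at_left_filter; exact: continuous_cos2.
- apply: continuous_in_subspaceT => t /set_mem; rewrite /= in_itv/= => /andP[t1 t2].
  have cb : 0 < cos b by apply: cos_gt0_pihalf; apply/andP; split; lra.
  have t0 : 0 < t by rewrite (lt_le_trans _ t1)// /cos2 mulrfctE mulr_gt0.
  have t1' : 0 < 1 - t.
    rewrite subr_gt0 (le_lt_trans t2)//.
    have <- : cos2 0 = 1 by rewrite /cos2 mulrfctE cos0 mulr1.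
    by apply: cos2_decr => //; lra.
  apply: cvgM; first exact: continuous_powR_gt0.
  apply: (@continuous_comp _ _ _ (fun t : R => 1 - t) (@powR R ^~ (1 / 2 - 1))).
    by apply: cvgB; [exact: cvg_cst|exact: cvg_id].
  exact: continuous_powR_gt0.
Qed.

(* starting at 1/3 keeps the segments [an n, pi/2 - an n] nonempty *)
Let an (n : nat) : R := n.+3%:R^-1.

Let an_gt0 n : 0 < an n. Proof. by rewrite invr_gt0. Qed.
Let an_le n : an n <= 3^-1.
Proof. by rewrite lef_pV2 ?posrE// ler_nat. Qed.
Let an_decr n m : (n <= m)%N -> an m <= an n.
Proof. by move=> nm; rewrite lef_pV2 ?posrE// ler_nat !ltnS. Qed.
Let an_small (e : R) : 0 < e -> exists n, an n <= e.
Proof.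
move=> e0; exists (Num.bound e^-1); rewrite /an -[leRHS]invrK lef_pV2 ?posrE ?invr_gt0//.
apply: (le_trans (ltW (archi_boundP _))); first by rewrite invr_ge0 ltW.
by rewrite ler_nat -addn3 leq_addr.
Qed.

(** Monotone convergence along the segments [an n, pi/2 - an n]. *)
Lemma beta_substitution (p : R) :
  (\int[mu]_(t in `]0%R, 1%R[) (G p t)%:E =
   \int[mu]_(x in `]0%R, (pi / 2)%R[) (2 * (cos x `^ p))%:E)%E.
Proof.
have pi2 := pi_ge2 R.
pose bn n := pi / 2 - an n.
pose A n : set R := `[an n, bn n]%classic.
pose B n : set R := `[cos2 (bn n), cos2 (an n)]%classic.
have anb n : an n <= bn n by have := an_le n; rewrite /bn; lra.
have UA : \bigcup_n A n = `]0%R, (pi / 2)%R[%classic.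
  apply/seteqP; split => x /=; rewrite in_itv/=.
    move=> [n _]; rewrite /A/= in_itv/= /bn => /andP[h1 h2].
    by have := an_gt0 n; move=> h; apply/andP; split; lra.
  move=> /andP[x0 x2].
  have [n hn] : exists n, an n <= Num.min x (pi / 2 - x).
    by apply: an_small; rewrite lt_min x0 subr_gt0.
  exists n => //; rewrite /A/= in_itv/= /bn.
  by move: hn; rewrite le_min => /andP[h1 h2]; apply/andP; split; lra.
have UB : \bigcup_n B n = `]0%R, 1%R[%classic.
  apply/seteqP; split => t /=; rewrite in_itv/=.
    move=> [n _]; rewrite /B/= in_itv/= => /andP[h1 h2].
    have := an_gt0 n; have := anb n; rewrite {1}/bn => h3 h4.
    have c1 : cos2 (an n) < 1.
      have <- : cos2 0 = 1 by rewrite /cos2 mulrfctE cos0 mulr1.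
      by apply: cos2_decr => //; rewrite /bn in h3; lra.
    have c0 : 0 < cos2 (bn n).
      have <- : cos2 (pi / 2) = 0 by rewrite /cos2 mulrfctE cos_pihalf mulr0.
      by apply: cos2_decr => //; rewrite /bn; lra.
    by apply/andP; split; [exact: lt_le_trans h1|exact: le_lt_trans c1].
  move=> /andP[t0 t1].
  have s0 : 0 < Num.sqrt t by rewrite sqrtr_gt0.
  have s1 : Num.sqrt t < 1 by rewrite -sqrtr1 ltr_sqrt.
  pose x := acos (Num.sqrt t).
  have sI : -1 <= Num.sqrt t <= 1 by apply/andP; split; lra.
  have cx : cos x = Num.sqrt t by rewrite acosK// in_itv.
  have tE : cos2 x = t by rewrite /cos2 mulrfctE cx -expr2 sqr_sqrtr// ltW.
  have x0 : 0 < x by apply: acos_gt0; apply/andP; split; lra.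
  have xpi : x <= pi by exact: acos_lepi.
  have x2 : x < pi / 2.
    rewrite ltNge; apply/negP => h; have : cos x <= cos (pi / 2).
      by rewrite leNgt ltr_cos ?in_itv/= -?leNgt//; apply/andP; split; lra.
    by rewrite cos_pihalf cx; lra.
  have : (\bigcup_n A n) x by rewrite UA/= in_itv/= x0.
  move=> [n _]; rewrite /A/= in_itv/= => /andP[h1 h2].
  exists n => //; rewrite /B/= in_itv/= -tE.
  move: (an_gt0 n) => an0.
  apply/andP; split.
    move: h2; rewrite le_eqVlt => /predU1P[->//|h2]; apply/ltW/cos2_decr => //; rewrite /bn; lra.
  by move: h1; rewrite le_eqVlt => /predU1P[->//|h1]; apply/ltW/cos2_decr => //; lra.
have ndA : nondecreasing_seq A.
  move=> n m nm; apply/subsetPset => x; rewrite /A/= !in_itv/= /bn => /andP[h1 h2].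
  by have := an_decr nm => h; apply/andP; split; lra.
have cos2_le x y : 0 <= x -> y <= pi / 2 -> x <= y -> cos2 y <= cos2 x.
  move=> x0 y2; rewrite le_eqVlt => /predU1P[->//|xy]; exact/ltW/cos2_decr.
have ndB : nondecreasing_seq B.
  move=> n m nm; apply/subsetPset => x; rewrite /B/= !in_itv/= => /andP[h1 h2].
  have h := an_decr nm; have g1 := an_gt0 m; have g2 := an_gt0 n.
  have g3 := anb n; have g4 := anb m.
  apply/andP; split.
    by apply: le_trans h1; apply: cos2_le; rewrite ?/bn; rewrite /bn in g3 g4; lra.
  by apply: (le_trans h2); apply: cos2_le; rewrite /bn in g3 g4; lra.
have mG : measurable_fun setT (fun t => (G p t)%:E).
  apply/measurable_EFinP; apply: measurable_funM; first exact: measurable_powR.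
  by apply: (measurableT_comp (measurable_powR _)); exact: measurable_funB.
have mC : measurable_fun setT (fun x : R => (2 * (cos x `^ p))%:E).
  apply/measurable_EFinP; apply: measurable_funM => //.
  apply: (measurableT_comp (measurable_powR _)).
  by apply: continuous_measurable_fun; exact: continuous_cos.
have LA : (\int[mu]_(x in A n) (2 * (cos x `^ p))%:E @[n --> \oo] -->
    \int[mu]_(x in `]0%R, (pi / 2)%R[) (2 * (cos x `^ p))%:E)%E.
  rewrite -UA; apply: ge0_nondecreasing_set_cvg_integral => //.
  - by move=> n; exact: measurable_itv.
  - by move=> n; exact: measurable_funTS.
  - by move=> n x _; rewrite lee_fin mulr_ge0// powR_ge0.
have LB : (\int[mu]_(t in B n) (G p t)%:E @[n --> \oo] -->
    \int[mu]_(t in `]0%R, 1%R[) (G p t)%:E)%E.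
  rewrite -UB; apply: ge0_nondecreasing_set_cvg_integral => //.
  - by move=> n; exact: measurable_itv.
  - by move=> n; exact: measurable_funTS.
  - by move=> n x _; rewrite lee_fin mulr_ge0// powR_ge0.
have E n : (\int[mu]_(t in B n) (G p t)%:E =
   \int[mu]_(x in A n) (2 * (cos x `^ p))%:E)%E.
  apply: beta_substitution_segment => //.
  by rewrite /bn; have := an_gt0 n; lra.
rewrite -(cvg_lim (@ereal_hausdorff R) LA) -(cvg_lim (@ereal_hausdorff R) LB).
exact: (congr1 (fun u => lim (u @ \oo)) (funext E)).
Qed.

Local Open Scope ereal_scope.

Let C (p : R) (t : R) : \bar R := (`|cos t| `^ p)%:E.

Let C0 p t : 0 <= C p t. Proof. by rewrite lee_fin powR_ge0. Qed.

Let mC p D : measurable_fun D (C p).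
Proof. by apply: measurable_funTS; exact: measurable_cos_powR. Qed.

(** The four quarter periods contribute equally. *)
Lemma cos_moment_quarter (p : R) :
  cos_moment p = 4%:E * \int[mu]_(x in `]0%R, (pi / 2)%R[) (cos x `^ p)%:E.
Proof.
have pi0 := pi_gt0 R.
have refl : \int[mu]_(t in `[(pi / 2)%R, pi[) C p t = \int[mu]_(t in `[0%R, (pi / 2)%R[) C p t.
  rewrite integral_mkcond.
  pose h := (C p \_ `[(pi / 2)%R, pi[) : R -> \bar R.
  have mh : measurable_fun [set: R] h.
    by apply/(measurable_restrictT (C p)).
  have h0 t : 0 <= h t by apply: erestrict_ge0.
  have N1 : (-1 != 0 :> R)%R by rewrite oppr_eq0 oner_eq0.
  have := ge0_integral_affine pi N1 mh h0.
  rewrite normrN1 invr1 mul1e => <-.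
  transitivity (\int[mu]_(t in `]0%R, (pi / 2)%R]) C p t).
    rewrite [RHS]integral_mkcond; apply: eq_integral => t _.
    rewrite /h !patchE !mem_setE !in_itv/=.
    rewrite (_ : (pi / 2 <= -1 * t + pi < pi)%R = (0 < t <= pi / 2)%R); last first.
      by apply/andP/andP => -[? ?]; split; lra.
    case: ifP => // _; rewrite /C; congr (EFin (powR _ _)).
    by rewrite mulN1r cosDpi cosN normrN.
  by rewrite integral_itv_obnd_cbnd// -integral_itv_bndo_bndc.
rewrite /cos_moment -integral_itv_bndo_bndc; last exact: mC.
rewrite (ge0_integral_itv_split (@mC p setT) (C0 p) (b := pi)); last by apply/andP; split; lra.
have -> : \int[mu]_(t in `[pi, (2 * pi)%R[) C p t = \int[mu]_(t in `[0%R, pi[) C p t.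
  have := ge0_integral_shift_itv 0 pi pi (@mC p setT) (C0 p).
  rewrite add0r (_ : pi + pi = 2 * pi)%R; last by lra.
  move=> <-; apply: eq_integral => t _; rewrite /C; congr (EFin (powR _ _)).
  by rewrite cosDpi normrN.
rewrite (ge0_integral_itv_split (@mC p setT) (C0 p) (a := 0%R) (b := pi / 2)%R); last first.
  by apply/andP; split; lra.
rewrite refl -integral_itv_obnd_cbnd; last exact: mC.
have -> : \int[mu]_(t in `]0%R, (pi / 2)%R[) C p t =
    \int[mu]_(x in `]0%R, (pi / 2)%R[) (cos x `^ p)%:E.
  apply: eq_integral => x /set_mem; rewrite /= in_itv/= => /andP[x0 x2].
  rewrite /C ger0_norm//; apply: cos_ge0_pihalf; apply/andP; split; lra.
set I := \int[mu]_(x in _) _.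
have I0 : 0 <= I by apply: integral_ge0 => x _; rewrite lee_fin powR_ge0.
rewrite (_ : 4%:E = (1 + 1) + (1 + 1)); last by rewrite -!EFinD; congr EFin; lra.
by rewrite !ge0_muleDl ?adde_ge0// !mul1e.
Qed.

Lemma Cp_beta (p : R) : (1 <= p)%R ->
  Cp p = ((pi^-1 * euler_beta ((p + 1) / 2) (1 / 2)) `^ p^-1)%R.
Proof.
move=> p1; rewrite /Cp; congr (powR _ _).
have -> : (\int[mu]_(t in `[0%R, (2 * pi)%R]) (`|cos t| `^ p))%R = fine (cos_moment p) by [].
have -> : euler_beta ((p + 1) / 2) (1 / 2) = fine (\int[mu]_(t in `]0%R, 1%R[) (G p t)%:E) by [].
rewrite beta_substitution cos_moment_quarter.
under [in RHS]eq_integral do rewrite EFinM.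
have mcos : measurable_fun [set: R] (fun x : R => (cos x `^ p)%:E).
  apply/measurable_EFinP; apply: (measurableT_comp (measurable_powR _)).
  by apply: continuous_measurable_fun; exact: continuous_cos.
rewrite (ge0_integralZl mu (measurable_itv _) (measurable_funTS mcos)); last 2 first.
- by move=> x _; rewrite lee_fin powR_ge0.
- by rewrite lee_fin.
set I := \int[mu]_(x in _) _.
have fI : I \is a fin_num.
  have := cos_moment_fin_num (le_trans ler01 p1); rewrite cos_moment_quarter -/I.
  by case: I => [r| |]//; rewrite ?gt0_muley ?gt0_muleNy ?lte_fin.
have pi0 : (pi != 0 :> R)%R by rewrite lt0r_neq0// pi_gt0.
rewrite !fineM//=; move: (fine I) (@pi R) pi0 => r P P0.
by field.
Qed.

End beta_constant.

(** * Passing to Borel representatives *)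

Section norms.
Context {R : realType} {d : nat}.
Notation rV := 'rV[R]_d.
Notation mu := (@lebesgue_rV R d).
Notation phase := (@lebesgue_phase R d).
Implicit Types (f g : rV -> R[i]) (z c : rV * rV) (Omega : set (rV * rV)).
Local Open Scope ereal_scope.

Lemma L2normE f : L2norm f = (energy f) `^ 2^-1.
Proof.
rewrite /L2norm unlock /=; congr (_ `^ _); apply: eq_integral => y _.
rewrite /= cmodE ger0_norm ?sqrtr_ge0//.
by rewrite powR_mulrn ?sqrtr_ge0// sqr_sqrtr ?nsq_ge0.
Qed.

Lemma L2norm_sqr f : L2norm f ^+ 2 = energy f.
Proof.
rewrite L2normE expe2; have := energy_ge0 f.
case: (energy f) => [r| |]//=; last by rewrite invr_eq0 pnatr_eq0 /= mulyy.
rewrite lee_fin => r0; rewrite -EFinM; congr EFin.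
by rewrite powR12_sqrt// -expr2 sqr_sqrtr.
Qed.

Lemma L2norm_lty f : (L2norm f < +oo) = (energy f < +oo).
Proof.
rewrite L2normE; apply/idP/idP; last exact: poweR_lty.
by apply: lty_poweRy; rewrite invr_eq0 pnatr_eq0.
Qed.

Lemma borelL2_L2 f : borelL2 f -> L2 f.
Proof.
move=> [[mf1 mf2] foo]; split; last by rewrite L2norm_lty.
- move=> B mB; exists ((fun y => complex.Re (f y)) @^-1` B).
    by rewrite -[X in measurable X]setTI; exact: mf1.
  by exists set0; [exact: negligible_set0|rewrite setU0].
- move=> B mB; exists ((fun y => complex.Im (f y)) @^-1` B).
    by rewrite -[X in measurable X]setTI; exact: mf2.
  by exists set0; [exact: negligible_set0|rewrite setU0].
Qed.

Lemma eq_energy_off_null (N : set rV) f g : measurable N -> mu N = 0 ->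
  (forall y, ~ N y -> f y = g y) -> energy f = energy g.
Proof.
move=> mN N0 fg; apply: (eq_integral_off_null mN N0) => y Ny.
by rewrite fg.
Qed.

Lemma L2_borel_rep f : L2 f -> exists h N, [/\ borelL2 h, measurable N, mu N = 0 &
  forall y, ~ N y -> f y = h y].
Proof.
move=> [f1 f2 foo].
have [u [N1 [mu1 mN1 N10 fu]]] := completed_measurable_rep f1.
have [v [N2 [mv2 mN2 N20 fv]]] := completed_measurable_rep f2.
pose h (y : rV) : R[i] := complex.Complex (u y : R) (v y : R).
have mN : measurable (N1 `|` N2) by exact: measurableU.
have N0 : mu (N1 `|` N2) = 0.
  apply/eqP; rewrite eq_le measure_ge0 andbT.
  by apply: (le_trans (measureU2 _ mN1 mN2)); rewrite [X in X + _]N10 [X in _ + X]N20 adde0.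
have fh y : ~ (N1 `|` N2) y -> f y = h y.
  by move=> /not_orP[y1 y2]; apply: complex_ext => /=; [exact: fu|exact: fv].
exists h, (N1 `|` N2); split => //; split; first by split.
by rewrite -(eq_energy_off_null mN N0 fh) -L2norm_lty.
Qed.

Lemma affine_preimage_null n (r : R) (t : 'rV[R]_n) (N : set 'rV[R]_n) : r != 0%R ->
  measurable N -> lebesgue_rV n N = 0 ->
  measurable ((fun x => r *: x + t)%R @^-1` N) /\
  lebesgue_rV n ((fun x => r *: x + t)%R @^-1` N) = 0.
Proof.
move=> r0 mN N0.
have mT : measurable ((fun x => r *: x + t)%R @^-1` N).
  by rewrite -[X in measurable X]setTI; exact: measurable_rV_affine.
split => //.
have m1 : measurable_fun setT (fun x => (\1_N x)%:E : \bar R).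
  by apply/measurable_EFinP; exact: measurable_indic.
have p1 x : 0 <= (\1_N x)%:E :> \bar R by rewrite lee_fin.
have := ge0_integral_rV_affine t r0 m1 p1.
rewrite [X in _ = _ * X]integral_indic// setIT [X in _ * X]N0 mule0 => <-.
transitivity (\int[lebesgue_rV n]_x (\1_((fun x => r *: x + t)%R @^-1` N) x)%:E).
  by rewrite integral_indic// setIT.
by [].
Qed.

Lemma eq_cintegral_off_null (N : set rV) (F G : rV -> R[i]) : measurable N ->
  mu N = 0 -> (forall y, ~ N y -> F y = G y) -> cintegral F = cintegral G.
Proof.
move=> mN N0 FG; apply: complex_ext => /=; congr fine;
  by apply: (eq_integral_off_null mN N0) => y Ny; rewrite FG.
Qed.

(** The null sets are pulled back by the affine maps y |-> x + y/2 and y |-> x - y/2,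
    so equality holds at every point and not merely almost everywhere. *)
Lemma eq_wigner_off_null (N1 N2 : set rV) f f' g g' z :
  measurable N1 -> mu N1 = 0 -> measurable N2 -> mu N2 = 0 ->
  (forall y, ~ N1 y -> f y = f' y) -> (forall y, ~ N2 y -> g y = g' y) ->
  wigner f g z = wigner f' g' z.
Proof.
move=> mN1 N10 mN2 N20 ff' gg'.
have h1 : (2^-1 != 0 :> R)%R by rewrite invr_eq0 pnatr_eq0.
have h2 : (- 2^-1 != 0 :> R)%R by rewrite oppr_eq0.
have [mA A0] := affine_preimage_null z.1 h1 mN1 N10.
have [mB B0] := affine_preimage_null z.1 h2 mN2 N20.
apply: (eq_cintegral_off_null (measurableU _ _ mA mB)).
  apply/eqP; rewrite eq_le measure_ge0 andbT.
  by apply: (le_trans (measureU2 _ mA mB)); rewrite [X in X + _]A0 [X in _ + X]B0 adde0.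
move=> y /not_orP[/= y1 y2].
by rewrite ff' ?gg' 1?addrC// -scaleNr.
Qed.

Lemma eq_tfshift_off_null (N : set rV) f f' z : measurable N -> mu N = 0 ->
  (forall y, ~ N y -> f y = f' y) ->
  exists N', [/\ measurable N', mu N' = 0 &
    forall y, ~ N' y -> tfshift z f y = tfshift z f' y].
Proof.
move=> mN N0 ff'.
have [mA A0] := affine_preimage_null (- z.1) (oner_neq0 R) mN N0.
eexists; split; [exact: mA|exact: A0|] => y /= Ny.
by rewrite /tfshift ff'//; rewrite scale1r in Ny.
Qed.

Lemma eq_wigner_tfshift (N1 N2 : set rV) f f' g g' (a b : rV * rV) z :
  measurable N1 -> mu N1 = 0 -> measurable N2 -> mu N2 = 0 ->
  (forall y, ~ N1 y -> f y = f' y) -> (forall y, ~ N2 y -> g y = g' y) ->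
  wigner (tfshift a f) (tfshift b g) z = wigner (tfshift a f') (tfshift b g') z.
Proof.
move=> mN1 N10 mN2 N20 ff' gg'.
have [M1 [mM1 M10 H1]] := eq_tfshift_off_null a mN1 N10 ff'.
have [M2 [mM2 M20 H2]] := eq_tfshift_off_null b mN2 N20 gg'.
exact: (eq_wigner_off_null z mM1 M10 mM2 M20 H1 H2).
Qed.

Lemma measure_preserving_translation_rV n (t : 'rV[R]_n) :
  measure_preserving (lebesgue_rV n) (fun x => (x + t)%R).
Proof.
have mt : measurable_fun setT (fun x : 'rV[R]_n => (x + t)%R).
  exact: (measurable_rVD (@measurable_id _ _ _) (measurable_cst t)).
split => // A mA.
have m1 : measurable_fun setT (fun x => (\1_A x)%:E : \bar R).
  by apply/measurable_EFinP; exact: measurable_indic.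
have p1 x : 0 <= (\1_A x)%:E :> \bar R by rewrite lee_fin.
have := ge0_integral_rV_affine t (oner_neq0 R) m1 p1.
rewrite normr1 invr1 expr1n mul1e [X in _ = X]integral_indic// setIT => <-.
have mT : measurable ((fun x => x + t)%R @^-1` A).
  by rewrite -[X in measurable X]setTI; exact: mt.
transitivity (\int[lebesgue_rV n]_x (\1_((fun x => x + t)%R @^-1` A) x)%:E).
  by rewrite integral_indic// setIT.
by apply: eq_integral => x _; rewrite scale1r.
Qed.

Lemma measure_preserving_translation c :
  measure_preserving phase (fun z => (z + c)%R).
Proof.
exact: (measure_preserving_prod (measure_preserving_translation_rV c.1)
  (measure_preserving_translation_rV c.2)).
Qed.

(** * Norms on phase space and the energy inequality *)

(** The p-th power of the L^p norm; the indicator is a factor so that it can be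
    moved by a change of variables. *)
Definition Lpmass (p : R) Omega (F : rV * rV -> R[i]) : \bar R :=
  \int[phase]_z (cmod (F z) `^ p * \1_Omega z)%:E.

Lemma Lpmass_ge0 p Omega F : 0 <= Lpmass p Omega F.
Proof. by apply: integral_ge0 => z _; rewrite lee_fin mulr_ge0// powR_ge0. Qed.

Lemma cmod_ge0 (w : R[i]) : (0 <= cmod w)%R.
Proof. by rewrite cmodE sqrtr_ge0. Qed.

Lemma LpnormE p Omega F : (0 < p)%R -> Lpnorm p Omega F = Lpmass p Omega F `^ p^-1.
Proof.
move=> p0; rewrite /Lpnorm unlock /=; congr (_ `^ _); apply: eq_integral => z _.
rewrite patchE indicE; case: ifP => _ /=.
  by rewrite ger0_norm ?cmod_ge0// mulr1.
by rewrite normr0 powR0 ?gt_eqF// mulr0.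
Qed.

Lemma eq_Lpmass_off_null (N : set (rV * rV)) p Omega Omega' F :
  measurable N -> phase N = 0 -> (forall z, ~ N z -> Omega z <-> Omega' z) ->
  Lpmass p Omega F = Lpmass p Omega' F.
Proof.
move=> mN N0 OO; apply: (eq_integral_off_null mN N0) => z Nz.
rewrite !indicE (_ : (z \in Omega) = (z \in Omega'))//.
by apply/idP/idP => /set_mem h; apply/mem_set; apply/OO.
Qed.

Lemma measurable_Lpmass (p : R) A (F : rV * rV -> R[i]) : measurable A -> measurableC F ->
  measurable_fun setT (fun z : rV * rV => (cmod (F z) `^ p * \1_A z)%R : R).
Proof.
move=> mA mF; apply: measurable_funM; last exact: measurable_indic.
apply: (measurableT_comp (measurable_powR p)).
apply: (measurable_fun_ext (g := fun z => Num.sqrt (nsq (F z)))).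
  by move=> z; rewrite cmodE.
apply: (measurableT_comp (continuous_measurable_fun (@sqrt_continuous R))).
exact: measurable_nsq.
Qed.

Lemma Lpnorm_scale p Omega (F G : rV * rV -> R[i]) (k : R) : (0 < p)%R -> (0 <= k)%R ->
  measurable Omega -> measurableC F ->
  (forall z, cmod (G z) = k * cmod (F z))%R ->
  Lpnorm p Omega G = k%:E * Lpnorm p Omega F.
Proof.
move=> p0 k0 mO mF GF; rewrite !LpnormE//.
have -> : Lpmass p Omega G = (k `^ p)%:E * Lpmass p Omega F.
  rewrite -ge0_integralZl//.
  - apply: eq_integral => z _; rewrite GF powRM ?cmod_ge0// -EFinM.
    by rewrite mulrA.
  - by apply/measurable_EFinP; exact: measurable_Lpmass.
  - by move=> z _; rewrite lee_fin mulr_ge0// powR_ge0.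
  - by rewrite lee_fin powR_ge0.
rewrite poweRM ?Lpmass_ge0 ?lee_fin ?powR_ge0//; congr (_ * _).
by rewrite poweR_EFin -powRrM divff ?gt_eqF// powRr1.
Qed.

Lemma Lpnorm_triangle p Omega (F1 F2 G : rV * rV -> R[i]) : (1 <= p)%R ->
  measurable Omega -> measurableC F1 -> measurableC F2 -> measurableC G ->
  (forall z, cmod (G z) <= cmod (F1 z) + cmod (F2 z))%R ->
  Lpnorm p Omega G <= Lpnorm p Omega F1 + Lpnorm p Omega F2.
Proof.
move=> p1 mO m1 m2 mG tri.
have p0 : (0 < p)%R by exact: lt_le_trans p1.
pose h (F : rV * rV -> R[i]) z := (cmod (F z) * \1_Omega z)%R.
have mh F : measurableC F -> measurable_fun setT (h F).
  move=> mF; apply: measurable_funM; last exact: measurable_indic.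
  apply: (measurable_fun_ext (g := fun z => Num.sqrt (nsq (F z)))).
    by move=> z; rewrite cmodE.
  apply: (measurableT_comp (continuous_measurable_fun (@sqrt_continuous R))).
  exact: measurable_nsq.
have hE F : Lpnorm p Omega F = 'N[phase]_p%:E[EFin \o h F].
  rewrite /Lpnorm; congr ('N[_]_ _ [_]); apply/funext => z; rewrite patchE /h/= indicE.
  by case: ifP; rewrite ?mulr1 ?mulr0.
rewrite !hE; apply: le_trans (minkowski_EFin _ (mh _ m1) (mh _ m2) p1).
have m12 := measurable_funD (mh _ m1) (mh _ m2).
have mpow (k : rV * rV -> R) : measurable_fun setT k ->
    measurable_fun setT (fun z => `|(k z)%:E| `^ p).
  move=> mk; apply/measurable_EFinP; apply: (measurableT_comp (measurable_powR p)).
  exact: measurableT_comp.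
rewrite unlock /=; apply: gt0_ler_poweR.
- by rewrite invr_ge0 ltW.
- by rewrite in_itv/= leey andbT; apply: integral_ge0 => z _; rewrite ?lee_fin ?powR_ge0 ?poweR_ge0.
- by rewrite in_itv/= leey andbT; apply: integral_ge0 => z _; rewrite ?lee_fin ?powR_ge0 ?poweR_ge0.
have h0 F z : (0 <= h F z)%R by rewrite mulr_ge0 ?cmod_ge0.
apply: ge0_le_integral => //.
- exact: (mpow _ (mh _ mG)).
- exact: (mpow _ m12).
- move=> z _; rewrite /= lee_fin ge0_ler_powR ?nnegrE ?(ltW p0)//.
  rewrite !ger0_norm ?addr_ge0 ?h0//.
  by rewrite /h -mulrDl ler_wpM2r.
Qed.

Lemma Lpnorm_cst0 p Omega : (0 < p)%R -> Lpnorm p Omega (cst 0%R) = 0.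
Proof.
move=> p0; rewrite LpnormE// /Lpmass (eq_integral (cst 0)).
  by rewrite integral0 poweR0r// invr_eq0 gt_eqF.
move=> z _; rewrite (ComplexField.Normc.normc0 R : cmod (cst 0%R z) = 0%R).
by rewrite powR0 ?mul0r// gt_eqF.
Qed.

Lemma wigner00 z : wigner (cst 0%R) (cst 0%R) z = 0%R.
Proof.
transitivity (cintegral (fun _ : rV => 0%R : R[i])).
  by congr cintegral; apply/funext => y; rewrite /= mulr0 mul0r.
by apply: complex_ext; rewrite /= /Rintegral (eq_integral (cst 0)) ?integral0.
Qed.

(** For [h] not almost everywhere 0 this is the definition of the supremum;
    otherwise W(h, h) vanishes identically. *)
Lemma le_concentration p Omega h : (0 < p)%R -> borelL2 h ->
  Lpnorm p Omega (wigner h h) <= concentration p Omega * energy h.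
Proof.
move=> p0 bh; have fh := borelL2_fin bh.
have [ae0|nae0] := pselect (\forall y \ae mu, h y = 0%R).
  have [N [mN N0 HN]] := ae0.
  have h0 y : ~ N y -> h y = cst 0%R y.
    by move=> Ny; apply: contrapT => hy; apply: Ny; apply: HN.
  have -> : wigner h h = cst 0%R.
    apply/funext => z; rewrite (eq_wigner_off_null z mN N0 mN N0 h0 h0).
    exact: wigner00.
  rewrite Lpnorm_cst0// (eq_energy_off_null mN N0 h0) /energy.
  rewrite (eq_integral (cst 0)); first by rewrite integral0 mule0.
  by move=> y _; rewrite /= /nsq /= !expr2 !mulr0 addr0.
have e0 : (0 < fine (energy h))%R.
  rewrite lt_neqAle fine_ge0 ?energy_ge0// andbT; apply/eqP => e0; apply: nae0.
  have mN : measurable_fun setT (fun y => (nsq (h y))%:E).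
    by apply/measurable_EFinP; apply: measurable_nsq; case: bh.
  have : \int[mu]_y `|(nsq (h y))%:E| = 0.
    under eq_integral do rewrite gee0_abs ?lee_fin ?nsq_ge0//.
    by rewrite -/(energy h) -(fineK fh) -e0.
  move=> /(ae_eq_integral_abs mu measurableT mN); apply: filterS => y /(_ I) /=.
  move=> /eqP; rewrite eqe /nsq paddr_eq0 ?sqr_ge0// !sqrf_eq0 => /andP[/eqP r0 /eqP i0].
  exact: complex_ext.
rewrite -[energy h]fineK// -lee_pdivrMr//; apply: ereal_sup_ubound.
exists h; first by split => //; exact: borelL2_L2.
by rewrite L2norm_sqr -[in LHS](fineK fh) inver gt_eqF.
Qed.

(** Interference is controlled by the two quadratic Wigner distributions of
    [u + v] and [u - v], whose energies add up by the parallelogram law. *)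
Lemma interference_le p Omega u v : (1 <= p)%R -> measurable Omega ->
  borelL2 u -> borelL2 v ->
  Lpnorm p Omega (fun z => wigner u v z + wigner v u z)%R <=
  concentration p Omega * (energy u + energy v).
Proof.
move=> p1 mO bu bv; have p0 : (0 < p)%R by exact: lt_le_trans p1.
have bD := borelL2D bu bv; have bB := borelL2D bu (borelL2N bv).
set S := (fun z => _).
have mS : measurableC S by apply: measurableC_D; apply: measurableC_wigner;
  [exact: bu.1|exact: bv.1|exact: bv.1|exact: bu.1].
have mWD := measurableC_wigner bD.1 bD.1; have mWB := measurableC_wigner bB.1 bB.1.
have cmod2 z : (cmod (2 * S z) = 2 * cmod (S z))%R.
  rewrite !cmodE nsqM (_ : nsq 2 = 2 ^+ 2)%R; last by rewrite /nsq/=; ring.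
  by rewrite sqrtrM ?sqr_ge0// sqrtr_sqr ger0_norm.
have E2 : Lpnorm p Omega (fun z => 2 * S z)%R = 2%:E * Lpnorm p Omega S.
  by apply: Lpnorm_scale.
have tri : Lpnorm p Omega (fun z => 2 * S z)%R <=
    Lpnorm p Omega (wigner (fun y => u y + v y) (fun y => u y + v y))%R +
    Lpnorm p Omega (wigner (fun y => u y - v y) (fun y => u y - v y))%R.
  apply: Lpnorm_triangle => //.
    apply: measurableC_M => //; split; exact: measurable_cst.
  move=> z; rewrite -wigner_polarization//.
  set x := wigner (fun y => u y + v y)%R _ z; set y := wigner (fun y => u y - v y)%R _ z.
  have <- : cmod (- y)%R = cmod y by rewrite !cmodE /nsq ReN ImN !sqrrN.
  exact: (le_normcD x (- y)%R).
have : 2%:E * Lpnorm p Omega S <= 2%:E * (concentration p Omega * (energy u + energy v)).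
  rewrite -E2; apply: (le_trans tri).
  apply: (le_trans (leeD (le_concentration Omega p0 bD) (le_concentration Omega p0 bB))).
  rewrite -ge0_muleDr ?energy_ge0// energy_parallelogram; [|exact: bu.1|exact: bv.1].
  by rewrite muleCA.
by rewrite lee_pmul2l.
Qed.

End norms.

(** * The limit of the interference term *)

Section limit_lemmas.
Context {R : realType}.

(** At l = 0 the power function is only continuous from the right, whence the
    sign hypothesis on the sequence. *)
Lemma cvg_powR_ge0 (u : nat -> R) (l q : R) : 0 < q -> (forall n, 0 <= u n) ->
  u @ \oo --> l -> (u n `^ q : R) @[n --> \oo] --> (l `^ q : R).
Proof.
move=> q0 u0 ul.
have l0 : 0 <= l by apply: (cvgr_to_ge ul); exact: nearW.
move: l0; rewrite le_eqVlt => /predU1P[l0|l0]; last first.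
  have cp := @continuous_powR_gt0 R q l l0.
  exact: (continuous_cvg _ cp ul).
rewrite -l0 powR0 ?gt_eqF//; apply/cvgrPdist_le => e e0.
have d0 : 0 < e `^ q^-1 by exact: powR_gt0.
near=> n; rewrite sub0r normrN ger0_norm ?powR_ge0//.
rewrite (_ : e = (e `^ q^-1) `^ q); last by rewrite -powRrM mulVf ?gt_eqF// powRr1// ltW.
rewrite ge0_ler_powR ?nnegrE ?(ltW q0) ?(ltW d0)//.
have : `|l - u n| <= e `^ q^-1 by near: n; move/cvgrPdist_le : ul; exact.
by rewrite -l0 sub0r normrN ger0_norm.
Unshelve. all: by end_near. Qed.

Lemma cvge_perturbation (X Y D : nat -> \bar R) (C : R) (l : R) : 0 <= C ->
  (forall n, 0 <= X n)%E -> (forall n, 0 <= D n)%E ->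
  (forall n, X n <= Y n + C%:E * D n)%E -> (forall n, Y n <= X n + C%:E * D n)%E ->
  D @ \oo --> 0%E -> Y @ \oo --> l%:E -> X @ \oo --> l%:E.
Proof.
move=> C0 X0 D0 XY YX cD cY.
have cCD : (C%:E * D n @[n --> \oo] --> 0)%E.
  by rewrite -(mule0 C%:E); exact: cvgeZl.
have c1 : ((Y n + C%:E * D n) @[n --> \oo] --> l%:E)%E.
  by rewrite -[l%:E]adde0; exact: cvgeD.
have c2 : ((Y n - C%:E * D n) @[n --> \oo] --> l%:E)%E.
  by rewrite -[l%:E]sube0; exact: cvgeB.
apply: (squeeze_cvge _ c2 c1); near=> n; apply/andP; split => //.
have fD : (C%:E * D n)%E \is a fin_num.
  by near: n; have /fine_cvgP[] := cCD.
by rewrite leeBlDr.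
Unshelve. all: by end_near. Qed.

Lemma cvg_fst_coord (d : nat) (u : nat -> 'rV[R]_d * 'rV[R]_d)
    (c : 'rV[R]_d * 'rV[R]_d) i :
  u @ \oo --> c -> (u n - c).1 ord0 i @[n --> \oo] --> (0 : R).
Proof.
move=> uc.
have vc : u n - c @[n --> \oo] --> (0 : 'rV[R]_d * 'rV[R]_d).
  by rewrite -(subrr c); apply: cvgB => //; exact: cvg_cst.
have v1 : (u n - c).1 @[n --> \oo] --> (0 : 'rV[R]_d * 'rV[R]_d).1.
  by apply: (cvg_comp _ _ vc); exact: cvg_fst.
have := cvg_comp _ _ v1 (@coord_continuous _ _ _ ord0 i (0 : 'rV[R]_d * 'rV[R]_d).1).
by rewrite mxE; exact.
Qed.

Lemma cvg_snd_coord (d : nat) (u : nat -> 'rV[R]_d * 'rV[R]_d)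
    (c : 'rV[R]_d * 'rV[R]_d) i :
  u @ \oo --> c -> (u n - c).2 ord0 i @[n --> \oo] --> (0 : R).
Proof.
move=> uc.
have vc : u n - c @[n --> \oo] --> (0 : 'rV[R]_d * 'rV[R]_d).
  by rewrite -(subrr c); apply: cvgB => //; exact: cvg_cst.
have v1 : (u n - c).2 @[n --> \oo] --> (0 : 'rV[R]_d * 'rV[R]_d).2.
  by apply: (cvg_comp _ _ vc); exact: cvg_snd.
have := cvg_comp _ _ v1 (@coord_continuous _ _ _ ord0 i (0 : 'rV[R]_d * 'rV[R]_d).2).
by rewrite mxE; exact.
Qed.

End limit_lemmas.

Section interference_limit.
Context {R : realType} {d : nat}.
Notation rV := 'rV[R]_d.
Notation phase := (@lebesgue_phase R d).
Variables (f g : rV -> R[i]) (bf : borelL2 f) (bg : borelL2 g).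
Variables (a b : nat -> rV * rV) (c : rV * rV).
Hypothesis hab : euclidean_norm (a n - b n) @[n --> \oo] --> +oo.
Hypothesis hc : 2^-1 *: (a n + b n) @[n --> \oo] --> c.
Variables (A : set (rV * rV)) (mA : measurable A) (Aoo : (phase A < +oo)%E).
Variables (p : R) (p1 : 1 <= p).

Let p0 : 0 < p. Proof. exact: lt_le_trans p1. Qed.
Let cn n := 2^-1 *: (a n + b n).
Let W := wigner f g.
Let S n z := wigner (tfshift (a n) f) (tfshift (b n) g) z +
    wigner (tfshift (b n) g) (tfshift (a n) f) z.
Let th n z := wigner_phase (a n) (b n) (z + cn n).
Let rot n z := cos (th n z) * complex.Re (W z) - sin (th n z) * complex.Im (W z).

(* S n is twice the real part of the covariant cross term, and rot n is that
   real part read at the moving centre cn n *)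
Let cmodS n z : cmod (S n (z + cn n)) = 2 * `|rot n z|.
Proof.
rewrite /S (@wigner_herm _ _ (tfshift (a n) f)); [|exact: borelL2_tfshift..].
rewrite wigner_covariance// -/(cn n) addrK -/W cmodE.
set w := _ * _.
have -> : nsq (w + w^*) = (2 * rot n z) ^+ 2.
  have -> : 2 * rot n z = 2 * complex.Re w by rewrite /w ReM.
  by rewrite /nsq ReD ImD ReJ ImJ; ring.
by rewrite sqrtr_sqr normrM ger0_norm.
Qed.

Let mW : measurableC W.
Proof. by apply: measurableC_wigner; [case: bf|case: bg]. Qed.

Let mth n : measurable_fun setT (th n).
Proof.
have mz : measurable_fun setT (fun z : rV * rV => z + cn n).
  by have [] := measure_preserving_translation (cn n).
rewrite /th /wigner_phase; apply: measurable_funM => //; apply: measurable_funB.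
- have mz1 := measurableT_comp measurable_fst mz.
  exact: (measurable_dotv (measurable_cst ((a n).2 - (b n).2)) mz1).
- have mz2 := measurableT_comp measurable_snd mz.
  exact: (measurable_dotv (measurable_rVB mz2 (measurable_cst (2^-1 *: ((a n).2 + (b n).2))))
    (measurable_cst ((a n).1 - (b n).1))).
Qed.

Let mrot n : measurable_fun setT (fun z => `|rot n z| `^ p).
Proof.
apply: (measurableT_comp (measurable_powR p)); apply: measurableT_comp => //.
have [m1 m2] := measurableC_expi (mth n); have [m3 m4] := mW.
by apply: measurable_funB; exact: measurable_funM.
Qed.

Let M := wigner_bound f g.

Let rot_le n z : `|rot n z| <= M + M.
Proof.
have [h1 h2] := wigner_le z bf bg.
rewrite (le_trans (ler_normB _ _))// lerD// normrM.
  by rewrite (le_trans _ h1)// ler_piMl// cos_max.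
by rewrite (le_trans _ h2)// ler_piMl// sin_max.
Qed.

Let mA1 : measurable [set z | A (z + c)].
Proof.
rewrite -[X in measurable X]setTI.
by have [+ _] := measure_preserving_translation c; exact.
Qed.

Let A1 := [set z | A (z + c)].

Let A1oo : (phase A1 < +oo)%E.
Proof. by have [_ /(_ A mA) E] := measure_preserving_translation c; rewrite [phase _]E. Qed.

Let u z := complex.Re (W z) * \1_A1 z.
Let v z := complex.Im (W z) * \1_A1 z.

Let bounded_restriction (h : rV * rV -> R) : measurable_fun setT h ->
  (forall z, `|h z| <= M) ->
  phase.-integrable setT (EFin \o (fun z => h z * \1_A1 z)) /\
  forall z, `|h z * \1_A1 z| <= M.
Proof.
move=> mh hM; have M0 : 0 <= M by exact: le_trans (normr_ge0 _) (hM 0).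
have bd z : `|h z * \1_A1 z| <= M * \1_A1 z.
  by rewrite normrM (ger0_norm (_ : 0 <= \1_A1 z))// ler_wpM2r.
have m1 : measurable_fun setT (\1_A1 : _ -> R) by exact: measurable_indic.
split; last first.
  by move=> z; rewrite (le_trans (bd z))// indicE; case: (_ \in _); rewrite ?mulr1 ?mulr0.
apply/integrableP; split.
  by apply/measurable_EFinP; exact: measurable_funM.
apply: (@le_lt_trans _ _ (\int[phase]_z (M%:E * (\1_A1 z)%:E))%E).
  apply: ge0_le_integral => //.
  - by apply/measurable_EFinP; apply: measurableT_comp => //; exact: measurable_funM.
  - by apply: measurable_funeM; exact/measurable_EFinP.
  - by move=> z _; rewrite /= -EFinM lee_fin.
rewrite ge0_integralZl//; last exact/measurable_EFinP.
by rewrite integral_indic// setIT lte_mul_pinfty.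
Qed.

(* the displacement along the gradient of the phase which advances it by t; its
   length is t / (2 pi |a n - b n|) *)
Let tau n (t : R) (z : rV * rV) : rV * rV :=
  z + (t / (2 * pi * (euclidean_norm (a n - b n)) ^+ 2)) *:
    (((a n).2 - (b n).2, - ((a n).1 - (b n).1)) : rV * rV).

Let normE n : euclidean_norm (a n - b n) ^+ 2 =
  dotv ((a n).1 - (b n).1) ((a n).1 - (b n).1) +
  dotv ((a n).2 - (b n).2) ((a n).2 - (b n).2).
Proof.
have dge0 (x : rV) : 0 <= dotv x x.
  by apply: sumr_ge0 => i _; rewrite -expr2 sqr_ge0.
by rewrite /euclidean_norm sqr_sqrtr ?addr_ge0.
Qed.

Let th_tau n t z : euclidean_norm (a n - b n) != 0 -> th n (tau n t z) = th n z + t.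
Proof.
move=> e0.
rewrite /th /wigner_phase /tau /=.
have := normE n; set e := euclidean_norm _ in e0 *.
set k := t / _; move: (cn n) => w.
set D1 := (a n).1 - _; set D2 := (a n).2 - _; set m := 2^-1 *: _ => eE.
rewrite !(dotvDr, dotvDl, dotvZr, dotvZl, dotvNl, dotvNr).
suff : 2 * pi * (k * (dotv D1 D1 + dotv D2 D2)) = t.
  by move=> <-; rewrite /D1 /D2 !(dotvDr, dotvDl, dotvNl, dotvNr); ring.
rewrite -eE /k; have pi0 : pi != 0 :> R by rewrite lt0r_neq0// pi_gt0.
by move: (@pi R) pi0 => P P0; field; rewrite e0 P0.
Qed.

Let coord_le (x : rV) i : x ord0 i ^+ 2 <= dotv x x.
Proof.
rewrite /dotv (bigD1 i)//= -expr2 lerDl; apply: sumr_ge0 => j _.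
by rewrite -expr2 sqr_ge0.
Qed.

Let cvg_shift (t_ : nat -> R) (h : nat -> R) : (forall n, 0 <= t_ n <= 2 * pi) ->
  (forall n, h n ^+ 2 <= euclidean_norm (a n - b n) ^+ 2) ->
  (t_ n / (2 * pi * (euclidean_norm (a n - b n)) ^+ 2)) * h n @[n --> \oo] --> 0.
Proof.
move=> tI hE; apply/cvgrPdist_le => e e0.
near=> n; rewrite sub0r normrN.
have : e^-1 <= euclidean_norm (a n - b n).
  by near: n; move/cvgryPge : hab; exact.
have := hE n; have /andP[t0 t2] := tI n.
set E := euclidean_norm _ => hE2 eE.
have E0 : 0 < E by apply: lt_le_trans eE; rewrite invr_gt0.
have pi0 : 0 < 2 * pi :> R by rewrite mulr_gt0// pi_gt0.
have hle : `|h n| <= E.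
  by rewrite -(@ler_pXn2r _ 2)// ?nnegrE// ?real_normK ?num_real// ltW.
rewrite normrM ger0_norm; last by rewrite divr_ge0// mulr_ge0 ?sqr_ge0// ltW.
apply: (@le_trans _ _ (E^-1)); last by rewrite -[leRHS]invrK lef_pV2 ?posrE ?invr_gt0.
apply: (@le_trans _ _ ((2 * pi) / (2 * pi * E ^+ 2) * E)).
  have k0 : 0 <= (2 * pi * E ^+ 2)^-1.
    by rewrite invr_ge0 mulr_ge0 ?sqr_ge0 ?(ltW pi0).
  by rewrite ler_pM ?mulr_ge0 ?ler_wpM2r.
rewrite le_eqVlt; apply/orP; left; apply/eqP.
move: (2 * pi) pi0 => P P0; field; rewrite !lt0r_neq0//.
Unshelve. all: by end_near. Qed.

Let flow (t_ : nat -> R) : (forall n, 0 <= t_ n <= 2 * pi) ->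
  vanishing_flow phase (fun n => tau n (t_ n)).
Proof.
move=> tI; apply: vanishing_translation_phase => i.
  under eq_fun do rewrite mxE.
  apply: cvg_shift => // n; rewrite normE (le_trans (coord_le _ _))// lerDr.
  by apply: sumr_ge0 => j _; rewrite -expr2 sqr_ge0.
under eq_fun do rewrite mxE.
apply: cvg_shift => // n; rewrite normE mxE sqrrN (le_trans (coord_le _ _))// lerDl.
by apply: sumr_ge0 => j _; rewrite -expr2 sqr_ge0.
Qed.

Local Open Scope ereal_scope.

Let J := \int[phase]_z (Num.sqrt (u z ^+ 2 + v z ^+ 2) `^ p)%:E.

Let JE : J = Lpmass p A1 W.
Proof.
apply: eq_integral => z _; congr EFin; rewrite /u /v cmodE /nsq indicE.
case: (_ \in _); rewrite ?mulr1//= !mulr0 expr0n addr0 sqrtr0.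
by rewrite powR0 ?gt_eqF.
Qed.

(* X n has the moving domain A - cn n and Y n the limit domain A - c *)
Let X n := \int[phase]_z (`|rot n z| `^ p * \1_A (z + cn n)%R)%:E.
Let Y n := \int[phase]_z (`|rot n z| `^ p * \1_A1 z)%:E.

Let mI n : measurable_fun setT (fun z : rV * rV => \1_A (z + cn n)%R : R).
Proof.
have [mz _] := measure_preserving_translation (cn n).
have m1 : measurable_fun setT (\1_A : rV * rV -> R) by exact: measurable_indic.
exact: (measurableT_comp m1 mz).
Qed.

Let massS n : Lpmass p A (S n) = (2 `^ p)%:E * X n.
Proof.
have mS : measurableC (S n).
  have [mf mg] := (bf.1, bg.1).
  by apply: measurableC_D; apply: measurableC_wigner; exact: measurableC_tfshift.
rewrite /Lpmass -(measure_preserving_integral (measure_preserving_translation (cn n))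
  (h := fun z => (cmod (S n z) `^ p * \1_A z)%:E)); last 2 first.
- by apply/measurable_EFinP; exact: measurable_Lpmass.
- by move=> z; rewrite lee_fin mulr_ge0// powR_ge0.
rewrite /X -ge0_integralZl//.
- by apply: eq_integral => z _; rewrite cmodS powRM// -EFinM mulrA.
- by apply/measurable_EFinP; apply: measurable_funM.
Qed.

Let Y_cvg : Y n @[n --> \oo] --> ((2 * pi)^-1)%:E * (J * cos_moment p).
Proof.
have [m1 m2] := mW.
have [iu uM] := bounded_restriction m1 (fun z => (wigner_le z bf bg).1).
have [iv vM] := bounded_restriction m2 (fun z => (wigner_le z bf bg).2).
have YE n : Y n = \int[phase]_z (`|cos (th n z) * u z - sin (th n z) * v z| `^ p)%:E.
  apply: eq_integral => z _; congr EFin; rewrite /rot /u /v indicE.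
  case: (_ \in _); rewrite ?mulr1//= !mulr0 subrr normr0 powR0 ?gt_eqF//.
under eq_fun do rewrite YE.
apply: (oscillatory_limit (M := M) p1 iu iv uM vM mth _ flow).
near=> n => t z; apply: th_tau.
have : (1 <= euclidean_norm (a n - b n))%R by near: n; move/cvgryPge : hab; exact.
by apply: contraTneq => ->; rewrite ler10.
Unshelve. all: by end_near. Qed.

Let D n := \int[phase]_z `|\1_A (z + cn n)%R - \1_A1 z|%:E.

Let D_cvg : D n @[n --> \oo] --> 0.
Proof.
have i1 : phase.-integrable setT (EFin \o (\1_A1 : _ -> R)).
  apply/integrableP; split; first by apply/measurable_EFinP; exact: measurable_indic.
  under eq_integral do rewrite /= ger0_norm//.
  by rewrite integral_indic// setIT.
have [|| _ /(_ _ i1)] := @vanishing_translation_phase R d (fun n => cn n - c)%R.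
- by move=> i; exact: (cvg_fst_coord i hc).
- by move=> i; exact: (cvg_snd_coord i hc).
rewrite /L1_asymp_fixed; set V := (X in X @ _ --> _).
suff -> : V = D by exact: id.
apply/funext => n; apply: eq_integral => z _.
congr (`| _ - _ |%:E)%R; rewrite !indicE /A1.
rewrite (_ : (z + (cn n - c) \in [set z | A (z + c)])%R = (z + cn n \in A)%R)//.
by apply/idP/idP => /set_mem h; apply/mem_set; move: h => /=; rewrite -addrA subrK.
Qed.

(* the two domains differ by o(1) in L^1 and the integrands are bounded by M + M *)
Let X_cvg : X n @[n --> \oo] --> ((2 * pi)^-1)%:E * (J * cos_moment p).
Proof.
have [m1 m2] := mW.
have [iu uM] := bounded_restriction m1 (fun z => (wigner_le z bf bg).1).
have [iv vM] := bounded_restriction m2 (fun z => (wigner_le z bf bg).2).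
have Jfin : J \is a fin_num := integral_modulus_fin_num p1 iu iv uM vM.
have Wfin : cos_moment p \is a fin_num := cos_moment_fin_num (ltW p0).
have mX n : measurable_fun setT (fun z : rV * rV => (`|rot n z| `^ p * \1_A (z + cn n)%R)%:E).
  apply/measurable_EFinP; apply: measurable_funM; [exact: mrot|exact: mI].
have mY n : measurable_fun setT (fun z : rV * rV => (`|rot n z| `^ p * \1_A1 z)%:E).
  by apply/measurable_EFinP; apply: measurable_funM => //; exact: measurable_indic.
have mD n : measurable_fun setT (fun z : rV * rV => `|\1_A (z + cn n)%R - \1_A1 z|%:E : \bar R).
  apply/measurable_EFinP; apply: measurableT_comp => //.
  by apply: (measurable_funB (mI n)); exact: measurable_indic.
have C0 : (0 <= (M + M) `^ p)%R by exact: powR_ge0.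
have key n (z : rV * rV) (x y : R) :
    (`|rot n z| `^ p * x)%:E <= (`|rot n z| `^ p * y)%:E + ((M + M) `^ p)%:E * `|x - y|%:E.
  rewrite -EFinM -EFinD lee_fin -lerBlDl -mulrBr.
  apply: (le_trans (ler_norm _)); rewrite normrM ler_wpM2r//.
  rewrite ger0_norm ?powR_ge0// ge0_ler_powR ?nnegrE ?(ltW p0)//.
  exact: le_trans (rot_le n z).
have lE : ((2 * pi)^-1)%:E * (J * cos_moment p) =
    ((2 * pi)^-1 * (fine J * fine (cos_moment p)))%:E.
  by rewrite EFinM EFinM !fineK.
rewrite lE; apply: (@cvge_perturbation R X Y D ((M + M) `^ p)) => //.
- by move=> n; apply: integral_ge0 => z _; rewrite lee_fin mulr_ge0// powR_ge0.
- by move=> n; apply: integral_ge0 => z _; rewrite lee_fin.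
- move=> n; apply: (le_integral_perturbation phase (mX n) (mY n) (mD n) _ _ _ C0).
  + by move=> z; rewrite lee_fin mulr_ge0// powR_ge0.
  + by move=> z; rewrite lee_fin mulr_ge0// powR_ge0.
  + by move=> z; rewrite lee_fin.
  + by move=> z; exact: key.
- move=> n; apply: (le_integral_perturbation phase (mY n) (mX n) (mD n) _ _ _ C0).
  + by move=> z; rewrite lee_fin mulr_ge0// powR_ge0.
  + by move=> z; rewrite lee_fin mulr_ge0// powR_ge0.
  + by move=> z; rewrite lee_fin.
  + by move=> z; rewrite (distrC (\1_A _)); exact: key.
- by rewrite -lE; exact: Y_cvg.
Qed.

(** For a Borel domain and Borel functions; [p]-th powers converge by
    [oscillatory_limit] and then the p-th root is taken. *)
Lemma interference_limit :
  Lpnorm p A (S n) @[n --> \oo] --> (2 * Cp p)%:E * Lpnorm p A1 W.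
Proof.
have [m1 m2] := mW.
have [iu uM] := bounded_restriction m1 (fun z => (wigner_le z bf bg).1).
have [iv vM] := bounded_restriction m2 (fun z => (wigner_le z bf bg).2).
have Jfin : J \is a fin_num := integral_modulus_fin_num p1 iu iv uM vM.
have Wfin : cos_moment p \is a fin_num := cos_moment_fin_num (ltW p0).
have J0 : 0 <= J by rewrite JE; exact: Lpmass_ge0.
have W0 := cos_moment_ge0 p.
have X0 n : 0 <= X n by apply: integral_ge0 => z _; rewrite lee_fin mulr_ge0// powR_ge0.
have pi0 : (0 < 2 * pi :> R)%R by rewrite mulr_gt0// pi_gt0.
have -> : (2 * Cp p)%:E * Lpnorm p A1 W =
    2%:E * (((2 * pi)^-1 * (fine J * fine (cos_moment p))) `^ p^-1)%:E.
  rewrite LpnormE// -JE -(fineK Jfin) poweR_EFin -EFinM -EFinM; congr EFin.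
  rewrite -mulrA; congr (_ * _)%R; rewrite /Cp -/(fine (cos_moment p)).
  rewrite -powRM ?mulr_ge0 ?invr_ge0 ?fine_ge0 ?(ltW pi0)//.
  by congr (powR _ _); rewrite mulrAC -mulrA.
have SE n : Lpnorm p A (S n) = 2%:E * (X n) `^ p^-1.
  rewrite LpnormE// massS poweRM ?lee_fin ?powR_ge0//; congr (_ * _).
  by rewrite poweR_EFin -powRrM divff ?gt_eqF// powRr1.
under eq_fun do rewrite SE.
apply: cvgeZl => //.
have lE : ((2 * pi)^-1)%:E * (J * cos_moment p) =
    ((2 * pi)^-1 * (fine J * fine (cos_moment p)))%:E.
  by rewrite EFinM EFinM !fineK.
have /fine_cvgP[fX cX] : X n @[n --> \oo] --> ((2 * pi)^-1 * (fine J * fine (cos_moment p)))%:E.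
  by rewrite -lE; exact: X_cvg.
apply/fine_cvgP; split.
  by apply: filterS fX => n /fineK <-.
rewrite [X in X @ _](_ : _ = fun n => (fine (X n) `^ p^-1)%R); last first.
  by apply/funext => n; exact: fine_poweR.
by apply: cvg_powR_ge0 => //; [rewrite invr_gt0|move=> n; exact: fine_ge0].
Qed.

End interference_limit.

(** * Lebesgue measurable sets and functions *)

Section monotone.
Context {R : realType}.
Local Open Scope ereal_scope.

(** A domain that is only Lebesgue measurable is measured here by extending the
    defining formulas of the measures to all sets; monotonicity is what bounds the
    measure of its Borel part. *)
Lemma le_product_measure d1 d2 (T1 : measurableType d1) (T2 : measurableType d2)
    (m1 : {measure set T1 -> \bar R}) (m2 : {measure set T2 -> \bar R}) :
  (forall A B : set T2, A `<=` B -> m2 A <= m2 B) ->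
  forall A B : set (T1 * T2), A `<=` B -> (m1 \x m2) A <= (m1 \x m2) B.
Proof.
move=> le2 A B AB; apply: ge0_le_integral_any => x //=.
by apply: le2; exact: le_xsection.
Qed.

Lemma le_lebesgue_rV n (A B : set 'rV[R]_n) : A `<=` B ->
  lebesgue_rV n A <= lebesgue_rV n B.
Proof.
elim: n A B => [|n IH] A B AB.
  rewrite /= /dirac lee_fin !indicE.
  by have [/set_mem/AB/mem_set->|] := boolP (0%R \in A).
by apply: (le_product_measure (@lebesgue_measure R) IH) => x; exact: AB.
Qed.

Lemma le_lebesgue_phase d (A B : set ('rV[R]_d * 'rV[R]_d)) : A `<=` B ->
  lebesgue_phase d A <= lebesgue_phase d B.
Proof. by apply: le_product_measure; exact: le_lebesgue_rV. Qed.

End monotone.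

Section completed_domain.
Context {R : realType} {d : nat}.
Notation rV := 'rV[R]_d.
Notation phase := (@lebesgue_phase R d).
Local Open Scope ereal_scope.

(** Up to a Borel null set [N], a Lebesgue measurable set is a Borel set [A],
    and the norms over the set and over its translates do not see [N]. *)
Lemma completed_Lpnorm (p : R) Omega : (0 < p)%R ->
  completed_algebra_gen phase Omega -> exists A : set (rV * rV),
  [/\ measurable A, A `<=` Omega,
      forall F, Lpnorm p Omega F = Lpnorm p A F &
      forall F c, Lpnorm p [set (z - c)%R | z in Omega] F =
        Lpnorm p [set z | A (z + c)%R] F].
Proof.
move=> p0 [A mA [N [N0 [mN0 N00 NN0]]] <-]; exists A; split => //.
- move=> F; rewrite !LpnormE//; congr (_ `^ _).
  apply: (eq_Lpmass_off_null p F mN0 N00) => z Nz; split; [|by left].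
  by case=> // /NN0.
- move=> F c; rewrite !LpnormE//; congr (_ `^ _).
  have [mt pt] := measure_preserving_translation c.
  apply: (@eq_Lpmass_off_null _ _ ((fun z => (z + c)%R) @^-1` N0)).
  + by rewrite -[X in measurable X]setTI; exact: mt.
  + exact: etrans (pt _ mN0) N00.
  + move=> z /= Nz; split.
      by move=> [w + zE]; move: Nz; rewrite -zE subrK => Nw [//|/NN0].
    by move=> Az; exists (z + c)%R; [left|rewrite addrK].
Qed.

End completed_domain.

Theorem theorem3p1 (R : realType) (d : nat) (f g : 'rV[R]_d -> R[i])
    (a b : nat -> 'rV[R]_d * 'rV[R]_d) (c : 'rV[R]_d * 'rV[R]_d)
    (hf : L2 f) (hg : L2 g)
    (hab : euclidean_norm (a n - b n) @[n --> \oo] --> +oo)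
    (hc : 2^-1 *: (a n + b n) @[n --> \oo] --> c)
    (Omega : set ('rV[R]_d * 'rV[R]_d))
    (mOmega : completed_algebra_gen (lebesgue_phase d) Omega)
    (Omega_gt0 : (0 < lebesgue_phase d Omega)%E)
    (Omega_lty : (lebesgue_phase d Omega < +oo)%E)
    (p : R) (hp : 1 <= p) :
  let S n (z : 'rV[R]_d * 'rV[R]_d) : R[i] :=
    wigner (tfshift (a n) f) (tfshift (b n) g) z +
    wigner (tfshift (b n) g) (tfshift (a n) f) z in
  let M := ((2 * Cp p)%:E * Lpnorm p [set (z - c)%R | z in Omega] (wigner f g))%E in
  [/\ Lpnorm p Omega (S n) @[n --> \oo] --> M,
      (M <= concentration p Omega * (L2norm f ^+ 2 + L2norm g ^+ 2))%E &
     Cp p = (pi^-1 * euler_beta ((p + 1) / 2) (1 / 2)) `^ p^-1].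
Proof.
have p0 : 0 < p by exact: lt_le_trans hp.
have [f' [Nf [bf mNf Nf0 ff']]] := L2_borel_rep hf.
have [g' [Ng [bg mNg Ng0 gg']]] := L2_borel_rep hg.
have [A [mA AO eO eOc]] := completed_Lpnorm p0 mOmega.
have Aoo : (lebesgue_phase d A < +oo)%E := le_lt_trans (le_lebesgue_phase AO) Omega_lty.
move=> S M.
pose S' n z := wigner (tfshift (a n) f') (tfshift (b n) g') z +
    wigner (tfshift (b n) g') (tfshift (a n) f') z.
have SE n : Lpnorm p Omega (S n) = Lpnorm p A (S' n).
  rewrite eO; congr Lpnorm; apply/funext => z; congr (_ + _).
    exact: (eq_wigner_tfshift (a n) (b n) z mNf Nf0 mNg Ng0 ff' gg').
  exact: (eq_wigner_tfshift (b n) (a n) z mNg Ng0 mNf Nf0 gg' ff').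
have ME : M = ((2 * Cp p)%:E * Lpnorm p [set z | A (z + c)%R] (wigner f' g'))%E.
  rewrite /M eOc; congr (_ * Lpnorm _ _ _)%E; apply/funext => z.
  exact: (eq_wigner_off_null z mNf Nf0 mNg Ng0 ff' gg').
have Slim : Lpnorm p Omega (S n) @[n --> \oo] --> M.
  under eq_fun do rewrite SE.
  rewrite ME; exact: (interference_limit bf bg hab hc mA Aoo hp).
split; [exact: Slim| |exact: Cp_beta].
apply: (cvge_to_le Slim); apply: nearW => n.
rewrite SE; apply: (le_trans (interference_le hp mA (borelL2_tfshift _ bf) (borelL2_tfshift _ bg))).
rewrite !L2norm_sqr (energy_tfshift _ bf.1) (energy_tfshift _ bg.1).
rewrite (eq_energy_off_null mNf Nf0 ff') (eq_energy_off_null mNg Ng0 gg').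
rewrite (_ : concentration p A = concentration p Omega)//.
congr ereal_sup; apply/seteqP; split => _ [h hh <-]; exists h => //; by rewrite eO.
Qed.
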